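(* For all $j \ge k \ge 1$, $i\mathsf{RCA}_0^\omega$ proves $\mathsf{LPO} \equiv_W \mathsf{LG}_k \equiv_W \mathsf{LG}_j$ (formalized Weihrauch equivalence).
   Context: $i\mathsf{RCA}_0^\omega$ is Kohlenbach's higher-order base system $\mathsf{RCA}_0^\omega$ with the logic restricted to intuitionistic logic. Graphs have vertex set $\mathbb N$ and are coded by functions $e:\mathbb N\to\mathbb N$: via a fixed primitive recursive bijection $\pi$ of $\mathbb N$ onto $\{(a,b):a<b\}$, $\pi(n)$ is an edge iff $e(n)\ne0$. $G_m$ is the subgraph on vertices $\{0,\dots,m\}$; a $k$-coloring of $G_m$ is a map into $\{0,\dots,k-1\}$ giving adjacent vertices distinct values. $\mathsf{LG}_k$ is the total problem $\forall G\exists n\,(\mathsf{LG}_k(G)=n)$, where $\mathsf{LG}_k(G)=n$ means: if $n=0$ then every $G_m$ is $k$-colorable; if $n>0$ then $G_n$ is not $k$-colorable and every $G_t$, $t<n$, is. $\mathsf{LPO}$ is the total problem $\forall p\exists n\,(\mathsf{LPO}(p)=n)$ for $p:\mathbb N\to\mathbb N$, where $\mathsf{LPO}(p)=n$ means: if $n=0$ then $p(j)>0$ for all $j$; if $n>0$ then $p(n-1)=0$ and $p(t)>0$ for all $t<n-1$. For total problems $\mathsf P:\forall x\exists y\,P(x,y)$ and $\mathsf Q:\forall u\exists v\,Q(u,v)$, the formalized reduction $\mathsf Q\le_W\mathsf P$ is the statement $\exists\Phi\exists\Psi\forall u\forall y\,(P(\Phi(u),y)\to Q(u,\Psi(y)))$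 with $\Phi,\Psi$ functionals of type $1\to1$; $\equiv_W$ means reductions in both directions. *)

(* Defs.v *)
(** The system iRCA_0^omega as a many-sorted intuitionistic first-order theory:
    a deep embedding with intrinsically typed terms and formulas.  Bound
    variables are de Bruijn indices; a context lists the types of the free
    variables, most recently bound first. *)

From Stdlib Require Import List.
Import ListNotations.

Inductive ty : Set :=
| N : ty
| Arr : ty -> ty -> ty.

Declare Scope ty_scope.
Delimit Scope ty_scope with ty.
Bind Scope ty_scope with ty.
Notation "s ~> t" := (Arr s t) (at level 55, right associativity) : ty_scope.
Open Scope ty_scope.

Definition one : ty := N ~> N.

Definition ctx := list ty.

Inductive var : ctx -> ty -> Set :=
| vz : forall G s, var (s :: G) s
| vs : forall G s t, var G t -> var (s :: G) t.
Arguments vz {G s}.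
Arguments vs {G s t} _.

(** [Pi] and [Sg] are the projection and substitution combinators, [Rec] is
    the recursor R_0, whose values are of type 0 only. *)
Inductive tm (G : ctx) : ty -> Set :=
| Var : forall s, var G s -> tm G s
| App : forall s t, tm G (s ~> t) -> tm G s -> tm G t
| Zero : tm G N
| Succ : tm G (N ~> N)
| Pi : forall s t, tm G (s ~> t ~> s)
| Sg : forall r s t, tm G ((r ~> s ~> t) ~> (r ~> s) ~> r ~> t)
| Rec : tm G (N ~> N ~> (N ~> N ~> N) ~> N).
Arguments Var {G s} _.
Arguments App {G s t} _ _.
Arguments Zero {G}.
Arguments Succ {G}.
Arguments Pi {G s t}.
Arguments Sg {G r s t}.
Arguments Rec {G}.

Declare Scope tm_scope.
Delimit Scope tm_scope with tm.
Bind Scope tm_scope with tm.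
Notation "f @ a" := (App f a) (at level 28, left associativity) : tm_scope.
Open Scope tm_scope.

Notation "'#0'" := (Var vz) : tm_scope.
Notation "'#1'" := (Var (vs vz)) : tm_scope.
Notation "'#2'" := (Var (vs (vs vz))) : tm_scope.
Notation "'#3'" := (Var (vs (vs (vs vz)))) : tm_scope.

Inductive fm : ctx -> Set :=
| Eq : forall G, tm G N -> tm G N -> fm G
| Bot : forall G, fm G
| And : forall G, fm G -> fm G -> fm G
| Or : forall G, fm G -> fm G -> fm G
| Imp : forall G, fm G -> fm G -> fm G
| All : forall G s, fm (s :: G) -> fm G
| Ex : forall G s, fm (s :: G) -> fm G.
Arguments Eq {G} _ _.
Arguments Bot {G}.
Arguments And {G} _ _.
Arguments Or {G} _ _.
Arguments Imp {G} _ _.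
Arguments All {G} s _.
Arguments Ex {G} s _.

Declare Scope fm_scope.
Delimit Scope fm_scope with fm.
Bind Scope fm_scope with fm.
Notation "a =0 b" := (Eq a b) (at level 40, no associativity) : fm_scope.
Notation "A &&& B" := (And A B) (at level 45, right associativity) : fm_scope.
Notation "A ==> B" := (Imp A B) (at level 55, right associativity) : fm_scope.
Open Scope fm_scope.

Definition Not {G} (A : fm G) : fm G := A ==> Bot.

Inductive qf : forall G, fm G -> Prop :=
| qf_Eq : forall G (a b : tm G N), qf G (a =0 b)
| qf_Bot : forall G, qf G Bot
| qf_And : forall G (A B : fm G), qf G A -> qf G B -> qf G (And A B)
| qf_Or : forall G (A B : fm G), qf G A -> qf G B -> qf G (Or A B)
| qf_Imp : forall G (A B : fm G), qf G A -> qf G B -> qf G (Imp A B).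
Arguments qf {G} _.

Definition ren (G D : ctx) := forall t, var G t -> var D t.
Definition sub (G D : ctx) := forall t, var G t -> tm D t.

Definition scons {G s} {T : ty -> Set} (a : T s) (f : forall t, var G t -> T t) :
  forall t, var (s :: G) t -> T t :=
  fun t v =>
    match v in var D t return
      match D with
      | [] => unit
      | s' :: G' => T s' -> (forall t, var G' t -> T t) -> T t
      end with
    | vz => fun a _ => a
    | vs w => fun _ f => f _ w
    end a f.

Fixpoint ren_tm {G D s} (r : ren G D) (a : tm G s) : tm D s :=
  match a with
  | Var v => Var (r _ v)
  | App f b => App (ren_tm r f) (ren_tm r b)
  | Zero => Zero
  | Succ => Succ
  | Pi => Pi
  | Sg => Sg
  | Rec => Rec
  end.

Fixpoint sub_tm {G D s} (f : sub G D) (a : tm G s) : tm D s :=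
  match a with
  | Var v => f _ v
  | App g b => App (sub_tm f g) (sub_tm f b)
  | Zero => Zero
  | Succ => Succ
  | Pi => Pi
  | Sg => Sg
  | Rec => Rec
  end.

Definition wk {G s} : ren G (s :: G) := fun _ v => vs v.
Definition shift {G t s} (a : tm G t) : tm (s :: G) t := ren_tm wk a.

Definition up {G D s} (f : sub G D) : sub (s :: G) (s :: D) :=
  scons (T := tm (s :: D)) #0 (fun t v => shift (f t v)).

Fixpoint sub_fm {G} (A : fm G) : forall D, sub G D -> fm D :=
  match A with
  | Eq a b => fun D f => Eq (sub_tm f a) (sub_tm f b)
  | Bot => fun D f => Bot
  | And A B => fun D f => And (sub_fm A D f) (sub_fm B D f)
  | Or A B => fun D f => Or (sub_fm A D f) (sub_fm B D f)
  | Imp A B => fun D f => Imp (sub_fm A D f) (sub_fm B D f)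
  | All s A => fun D f => All s (sub_fm A (s :: D) (up f))
  | Ex s A => fun D f => Ex s (sub_fm A (s :: D) (up f))
  end.
Arguments sub_fm {G} A {D} f.

Definition ids {G} : sub G G := fun _ v => Var v.
Definition shifts {G s} : sub G (s :: G) := fun _ v => Var (vs v).
Definition shift_fm {G s} (A : fm G) : fm (s :: G) := sub_fm A shifts.
Definition inst {G s} (A : fm (s :: G)) (a : tm G s) : fm G :=
  sub_fm A (scons (T := tm G) a ids).

Inductive prv (ax : forall G, fm G -> Prop) :
  forall G, list (fm G) -> fm G -> Prop :=
| p_hyp : forall G H (A : fm G), In A H -> prv ax G H A
| p_ax : forall G H (A : fm G), ax G A -> prv ax G H A
| p_botE : forall G H (A : fm G), prv ax G H Bot -> prv ax G H A
| p_andI : forall G H (A B : fm G),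
    prv ax G H A -> prv ax G H B -> prv ax G H (And A B)
| p_andE1 : forall G H (A B : fm G), prv ax G H (And A B) -> prv ax G H A
| p_andE2 : forall G H (A B : fm G), prv ax G H (And A B) -> prv ax G H B
| p_orI1 : forall G H (A B : fm G), prv ax G H A -> prv ax G H (Or A B)
| p_orI2 : forall G H (A B : fm G), prv ax G H B -> prv ax G H (Or A B)
| p_orE : forall G H (A B C : fm G),
    prv ax G H (Or A B) -> prv ax G (A :: H) C -> prv ax G (B :: H) C ->
    prv ax G H C
| p_impI : forall G H (A B : fm G),
    prv ax G (A :: H) B -> prv ax G H (Imp A B)
| p_impE : forall G H (A B : fm G),
    prv ax G H (Imp A B) -> prv ax G H A -> prv ax G H B
| p_allI : forall G H s (A : fm (s :: G)),
    prv ax (s :: G) (map shift_fm H) A -> prv ax G H (All s A)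
| p_allE : forall G H s (A : fm (s :: G)) (a : tm G s),
    prv ax G H (All s A) -> prv ax G H (inst A a)
| p_exI : forall G H s (A : fm (s :: G)) (a : tm G s),
    prv ax G H (inst A a) -> prv ax G H (Ex s A)
| p_exE : forall G H s (A : fm (s :: G)) (C : fm G),
    prv ax G H (Ex s A) ->
    prv ax (s :: G) (A :: map shift_fm H) (shift_fm C) -> prv ax G H C.

(** Equality at higher types is not primitive: it abbreviates
    [forall z1 ... zn, a z1 ... zn =0 b z1 ... zn]. *)
Fixpoint EqT {G} (s : ty) : tm G s -> tm G s -> fm G :=
  match s with
  | N => fun a b => a =0 b
  | s1 ~> s2 => fun a b => All s1 (EqT s2 (shift a @ #0) (shift b @ #0))
  end.
Arguments EqT {G s} a b.

(** In [ax_ind], the step formula is [A(S x)].  In [ax_qfac], [A] has the free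
    variables [y : 0] (index 0) and [x : 1] (index 1); the conclusion lives in
    the context [x, Y, G] and is [A(x, Y x)].  Other variables of [G] are
    parameters. *)
Inductive iRCA : forall G, fm G -> Prop :=
| ax_refl : forall G (a : tm G N), iRCA G (a =0 a)
| ax_sym : forall G (a b : tm G N), iRCA G (a =0 b ==> b =0 a)
| ax_trans : forall G (a b c : tm G N),
    iRCA G (a =0 b ==> b =0 c ==> a =0 c)
| ax_ext : forall G s t (f : tm G (s ~> t)) (a b : tm G s),
    iRCA G (EqT a b ==> EqT (f @ a) (f @ b))
| ax_succ_nz : forall G (a : tm G N), iRCA G (Not (Succ @ a =0 Zero))
| ax_succ_inj : forall G (a b : tm G N),
    iRCA G (Succ @ a =0 Succ @ b ==> a =0 b)
| ax_Pi : forall G s t (a : tm G s) (b : tm G t), iRCA G (EqT (Pi @ a @ b) a)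
| ax_Sg : forall G r s t
    (a : tm G (r ~> s ~> t)) (b : tm G (r ~> s)) (c : tm G r),
    iRCA G (EqT (Sg @ a @ b @ c) (a @ c @ (b @ c)))
| ax_Rec0 : forall G (b : tm G N) (c : tm G (N ~> N ~> N)),
    iRCA G (Rec @ Zero @ b @ c =0 b)
| ax_RecS : forall G (a b : tm G N) (c : tm G (N ~> N ~> N)),
    iRCA G (Rec @ (Succ @ a) @ b @ c =0 c @ (Rec @ a @ b @ c) @ a)
| ax_ind : forall G (A : fm (N :: G)), qf A ->
    iRCA G (inst A Zero ==>
            All N (A ==> sub_fm A (scons (T := tm (N :: G)) (Succ @ #0) shifts)) ==>
            All N A)
| ax_qfac : forall G (A : fm (N :: one :: G)), qf A ->
    iRCA G (All one (Ex N A) ==>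
            Ex (one ~> N)
              (All one
                 (sub_fm A
                    (scons (T := tm (one :: (one ~> N) :: G)) (#1 @ #0)
                    (scons (T := tm (one :: (one ~> N) :: G)) #0
                       (fun _ v => Var (vs (vs v)))))))).

Definition iRCA_proves (A : fm []) : Prop := prv iRCA [] [] A.
Notation "'iRCA0w' '|--' A" := (iRCA_proves A) (at level 70).

(** Bracket abstraction. *)
Fixpoint lam {s G t} (a : tm (s :: G) t) : tm G (s ~> t) :=
  match a with
  | Var v =>
      scons (T := fun t => tm G (s ~> t))
        (Sg @ Pi @ (Pi (t := s ~> s)))
        (fun _ w => Pi @ Var w) _ v
  | App f b => Sg @ lam f @ lam b
  | Zero => Pi @ Zero
  | Succ => Pi @ Succ
  | Pi => Pi @ Pi
  | Sg => Pi @ Sg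
  | Rec => Pi @ Rec
  end.

Fixpoint num {G} (n : nat) : tm G N :=
  match n with 0 => Zero | S n => Succ @ num n end.

(** [step], with [#1] the previous value and [#0] the argument, is the step of
    a primitive recursion on [x]. *)
Definition primrec {G} (x base : tm G N) (step : tm (N :: N :: G) N) : tm G N :=
  Rec @ x @ base @ lam (lam step).

Definition pred {G} (x : tm G N) : tm G N := primrec x Zero #0.
Definition add {G} (x y : tm G N) : tm G N := primrec y x (Succ @ #1).
Definition monus {G} (x y : tm G N) : tm G N := primrec y x (pred #1).

Definition Le {G} (x y : tm G N) : fm G := monus x y =0 Zero.
Definition Lt {G} (x y : tm G N) : fm G := Le (Succ @ x) y.

(** [pi n = (pi1 n, pi2 n)] enumerates the pairs [a < b] in the order
    (0,1), (0,2), (1,2), (0,3), ...: the pairs with larger component [b] are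
    the values at [tri b, ..., tri b + (b - 1)], where [tri b = b(b-1)/2].  So
    [pi2] goes from [b] to [b + 1] on reaching [tri (b + 1)]. *)
Definition tri {G} (b : tm G N) : tm G N := primrec b Zero (add #1 #0).
Definition pi2 {G} (n : tm G N) : tm G N :=
  primrec n (num 1)
    (add #1 (monus (num 1) (monus (tri (Succ @ #1)) (Succ @ #0)))).
Definition pi1 {G} (n : tm G N) : tm G N := monus n (tri (pi2 n)).

(** The matrix [P(x, y)] of a problem [forall x exists y, P(x, y)] with [x], [y]
    of type 1; [y] is index 0 and [x] is index 1. *)
Definition problem := fm [one; one].

Definition holds {G} (P : problem) (x y : tm G one) : fm G :=
  sub_fm P (scons (T := tm G) y (scons (T := tm G) x
    (fun t (v : var [] t) => match v with end))).

(** The variables are, from index 3 down to index 0, [Phi], [Psi], [u], [y]. *)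
Definition reduces (Q P : problem) : fm [] :=
  Ex (one ~> one) (Ex (one ~> one) (All one (All one
    (holds P (#3 @ #1) #0 ==> holds Q #1 (#2 @ #0))))).

Definition equivW (P Q : problem) : fm [] := reduces P Q &&& reduces Q P.

(** A solution that is a number is given to, and returned by, a functional of
    type [1 -> 1] as a function whose value at 0 is that number. *)
Definition value {G} (y : tm G one) : tm G N := y @ Zero.

Definition LPO_is {G} (p : tm G one) (n : tm G N) : fm G :=
  (n =0 Zero ==> All N (Lt Zero (shift p @ #0))) &&&
  (Lt Zero n ==>
     p @ pred n =0 Zero &&&
     All N (Lt #0 (pred (shift n)) ==> Lt Zero (shift p @ #0))).

(** [pi n] is an edge of the graph coded by [e], with both ends among the
    vertices [0, ..., m]. *)
Definition Edge {G} (e : tm G one) (m n : tm G N) : fm G :=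
  Not (e @ n =0 Zero) &&& Le (pi1 n) m &&& Le (pi2 n) m.

(** A coloring of [G_m] is a function [c] of type 1, of which only the values
    at [0, ..., m] matter. *)
Definition Coloring {G} (k : nat) (e : tm G one) (m : tm G N) (c : tm G one) :
  fm G :=
  All N (Le #0 (shift m) ==> Lt (shift c @ #0) (num k)) &&&
  All N (Edge (shift e) (shift m) #0 ==>
         Not (shift c @ pi1 #0 =0 shift c @ pi2 #0)).

Definition Colorable {G} (k : nat) (e : tm G one) (m : tm G N) : fm G :=
  Ex one (Coloring k (shift e) (shift m) #0).

Definition LG_is {G} (k : nat) (e : tm G one) (n : tm G N) : fm G :=
  (n =0 Zero ==> All N (Colorable k (shift e) #0)) &&&
  (Lt Zero n ==>
     Not (Colorable k e n) &&&
     All N (Lt #0 (shift n) ==> Colorable k (shift e) #0)).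

Definition LPO : problem := LPO_is #1 (value #0).
Definition LG (k : nat) : problem := LG_is k #1 (value #0).

(* Main.v *)
Require Import Defs.
From Stdlib Require Import List Setoid Morphisms Lia.
Import ListNotations.

(** LPO reduces to LG_k: from [p] build the graph in which the vertices below
    [k] form a clique and a vertex [b >= k] is joined to all smaller vertices
    exactly when [b - k] is the first zero of [p].  If [s] is the first zero,
    [G_(k+s)] contains a [(k+1)]-clique and no smaller [G_m] fails to be
    [k]-colorable, so the first zero is read off the answer alone.

    LG_k reduces to LPO: [G_m] is [k]-colorable iff some number below
    [k^(m+1)], read in base [k], lists the colors of a coloring; this is a
    bounded search, done by a term of the system.  As [G_0] is colorable,
    testing [G_(j+1)] at the argument [j] makes the answers coincide.

    LG_j reduces to LG_k by composing the two. *)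

(** * Substitution and weakening *)

(** The obstacle is that induction is available for quantifier-free formulas only, in intuitionistic
    logic, while colorability is existential and being a first zero involves a bounded quantifier.
    Whatever has to be decided or proved by induction is therefore expressed by a term being zero or
    positive: [allnz] replaces a bounded universal quantifier, [wit] extracts the witness, and
    premises that vary with the induction variable are kept as object-level implications. Even an
    induction on two variables cannot quantify over the second one, hence [prv_dind].

    The numbers of colors are numerals, one derivation for each, so the pigeonhole principle may be
    proved by induction outside the theory. [Psi] sees the answer but not the input. This works
    because, for [k + 1] colors, a first zero at [s] puts the least uncolorable subgraph at
    [k + 1 + s], whereas LPO answers [s + 1]: the difference is the constant [k], and truncated
    subtraction also sends the answer 0 to 0. *)

Arguments shift : simpl never.

(** Inversion of the indexed family [var]; the match returns a statement depending on the shape of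
    the context, so no axiom on equality proofs enters. *)
Lemma var_case {G s} (P : forall t, var (s :: G) t -> Prop) :
  P s vz -> (forall t v, P t (vs v)) -> forall t v, P t v.
Proof.
intros hz hs t v; revert hz hs.
refine (match v as v0 in var D t0 return
  match D as D0 return var D0 t0 -> Prop with
  | [] => fun _ => True
  | s' :: G' => fun w => forall P : (forall t, var (s' :: G') t -> Prop),
     P s' vz -> (forall t v, P t (vs v)) -> P t0 w
  end v0 with vz => _ | vs w => _ end P); auto.
Qed.

Lemma sub_tm_ext {G D t} (f g : sub G D) (a : tm G t) :
  (forall t v, f t v = g t v) -> sub_tm f a = sub_tm g a.
Proof. intros E; induction a; cbn; congruence. Qed.

Lemma ren_sub_tm {G D t} (r : ren G D) (a : tm G t) :
  ren_tm r a = sub_tm (fun t v => Var (r t v)) a.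
Proof. induction a; cbn; congruence. Qed.

(** Every weakening becomes a substitution by [shifts], so that the single composition law
    [sub_sub_tm] normalizes all terms. *)
Lemma shift_sub {G s t} (a : tm G t) : shift (s := s) a = sub_tm shifts a.
Proof. apply ren_sub_tm. Qed.

Lemma sub_sub_tm {G D E t} (f : sub G D) (g : sub D E) (a : tm G t) :
  sub_tm g (sub_tm f a) = sub_tm (fun t v => sub_tm g (f t v)) a.
Proof. induction a; cbn; congruence. Qed.

Lemma sub_ids {G t} (a : tm G t) : sub_tm ids a = a.
Proof. induction a; cbn; unfold ids in *; congruence. Qed.

Lemma sub_scons_shifts {G D s t} (f : sub G D) (b : tm D s) (a : tm G t) :
  sub_tm (scons b f) (sub_tm shifts a) = sub_tm f a.
Proof. now rewrite sub_sub_tm; apply sub_tm_ext. Qed.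

Lemma sub_up_shifts {G D s t} (f : sub G D) (a : tm G t) :
  sub_tm (up (s := s) f) (sub_tm shifts a) = sub_tm shifts (sub_tm f a).
Proof.
rewrite !sub_sub_tm; apply sub_tm_ext; intros u v; cbn; apply shift_sub.
Qed.

Lemma sub_up_ext {G D s} (f g : sub G D) :
  (forall t v, f t v = g t v) -> forall t v, up (s := s) f t v = up g t v.
Proof. intros E; apply var_case; [easy | intros u v; cbn; now rewrite E]. Qed.

Lemma sub_fm_ext {G} (A : fm G) : forall D (f g : sub G D),
  (forall t v, f t v = g t v) -> sub_fm A f = sub_fm A g.
Proof.
induction A; intros D f g E; cbn; f_equal; auto using @sub_tm_ext, @sub_up_ext.
Qed.

Lemma sub_sub_fm {G} (A : fm G) : forall D E (f : sub G D) (g : sub D E),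
  sub_fm (sub_fm A f) g = sub_fm A (fun t v => sub_tm g (f t v)).
Proof.
induction A; intros D E f g; cbn; f_equal; auto using @sub_sub_tm;
  rewrite IHA; apply sub_fm_ext; apply var_case; try easy;
  intros t v; cbn; now rewrite !shift_sub, sub_up_shifts.
Qed.

Lemma sub_fm_ids {G} (A : fm G) : sub_fm A ids = A.
Proof.
induction A; cbn; f_equal; auto using @sub_ids; rewrite <- IHA at 2;
  apply sub_fm_ext; now apply var_case.
Qed.

Lemma sub_inst {G D s} (f : sub G D) (A : fm (s :: G)) (a : tm G s) :
  sub_fm (inst A a) f = inst (sub_fm A (up f)) (sub_tm f a).
Proof.
unfold inst; rewrite !sub_sub_fm; apply sub_fm_ext; apply var_case; [easy|].
intros t v; cbn; now rewrite shift_sub, sub_scons_shifts, sub_ids.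
Qed.

Lemma sub_up_shift_fm {G D s} (f : sub G D) (A : fm G) :
  sub_fm (shift_fm (s := s) A) (up f) = shift_fm (sub_fm A f).
Proof.
unfold shift_fm; rewrite !sub_sub_fm; apply sub_fm_ext; intros t v; cbn.
apply shift_sub.
Qed.

Lemma sub_EqT {s} : forall G D (f : sub G D) (a b : tm G s),
  sub_fm (EqT a b) f = EqT (sub_tm f a) (sub_tm f b).
Proof.
induction s; intros G D f a b; cbn; [easy|].
now rewrite IHs2; cbn; rewrite !shift_sub, !sub_up_shifts.
Qed.

Lemma sub_qf {G} (A : fm G) : qf A -> forall D (f : sub G D), qf (sub_fm A f).
Proof. induction 1; intros D f; cbn; constructor; auto. Qed.

(** The axioms are schemes over arbitrary contexts; only induction and choice, whose formulas
    contain substitutions themselves, require commuting two substitutions. *)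
Lemma sub_iRCA {G D} (f : sub G D) (A : fm G) : iRCA G A -> iRCA D (sub_fm A f).
Proof.
intros a; destruct a; cbn; rewrite ?sub_EqT; try (constructor; fail).
- rewrite sub_inst; cbn.
  replace (sub_fm (sub_fm A _) (up f)) with
    (sub_fm (sub_fm A (up f)) (scons (T := tm (N :: D)) (Succ @ #0) shifts));
    [now constructor; apply sub_qf|].
  rewrite !sub_sub_fm; apply sub_fm_ext; apply var_case; [easy|].
  intros t v; cbn; now rewrite shift_sub, sub_scons_shifts.
- match goal with |- iRCA _ (_ ==> Ex _ (All _ ?B)) =>
    replace B with (sub_fm (sub_fm A (up (up f)))
       (scons (T := tm (one :: (one ~> N) :: D)) (#1 @ #0)
       (scons (T := tm (one :: (one ~> N) :: D)) #0
          (fun _ v => Var (vs (vs v)))))) end.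
  + now constructor; apply sub_qf.
  + rewrite !sub_sub_fm; apply sub_fm_ext; apply var_case; [easy|].
    apply var_case; [easy|].
    intros t v; cbn.
    rewrite !shift_sub, sub_scons_shifts, sub_scons_shifts, sub_sub_tm.
    now apply sub_tm_ext.
Qed.

Lemma prv_weaken {G} (H : list (fm G)) A :
  prv iRCA G H A -> forall H', incl H H' -> prv iRCA G H' A.
Proof.
induction 1; intros H' I.
- apply p_hyp; auto.
- now apply p_ax.
- now apply p_botE; auto.
- now apply p_andI; auto.
- now eapply p_andE1; auto.
- now eapply p_andE2; auto.
- now apply p_orI1; auto.
- now apply p_orI2; auto.
- eapply p_orE; [apply IHprv1 | apply IHprv2 | apply IHprv3]; auto;
    now apply incl_cons; [left | apply incl_tl].
- apply p_impI, IHprv; now apply incl_cons; [left | apply incl_tl].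
- now eapply p_impE; auto.
- now apply p_allI, IHprv, incl_map.
- now apply p_allE; auto.
- now eapply p_exI; auto.
- eapply p_exE; [now apply IHprv1|]; apply IHprv2.
  apply incl_cons; [now left|]; now apply incl_tl, incl_map.
Qed.

(** This is what lets facts already derived be moved under a quantifier, by taking [shifts] for
    [f]. *)
Lemma prv_sub {G} (H : list (fm G)) A : prv iRCA G H A ->
  forall D (f : sub G D), prv iRCA D (map (fun B => sub_fm B f) H) (sub_fm A f).
Proof.
assert (E : forall G D s (f : sub G D) H,
  map (fun B => sub_fm B (up f)) (map (shift_fm (s := s)) H)
  = map shift_fm (map (fun B => sub_fm B f) H)).
{ intros; rewrite !map_map; apply map_ext; intros; apply sub_up_shift_fm. }
induction 1; intros D f; cbn in *.
- apply p_hyp; change (In ((fun B => sub_fm B f) A) (map (fun B => sub_fm B f) H)).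
  now apply in_map.
- now apply p_ax, sub_iRCA.
- now apply p_botE; auto.
- now apply p_andI; auto.
- now eapply p_andE1; eauto.
- now eapply p_andE2; eauto.
- now apply p_orI1; auto.
- now apply p_orI2; auto.
- now eapply p_orE; [apply IHprv1 | apply IHprv2 | apply IHprv3].
- now apply p_impI; auto.
- now eapply p_impE; eauto.
- now apply p_allI; rewrite <- E.
- rewrite sub_inst; now apply p_allE, IHprv.
- eapply p_exI; rewrite <- sub_inst; apply IHprv.
- eapply p_exE; [apply IHprv1|].
  specialize (IHprv2 _ (up f)).
  now rewrite E, sub_up_shift_fm in IHprv2.
Qed.

(** * Equality as a congruence *)

Notation "H ||- A" := (prv iRCA _ H A%fm) (at level 70).

Definition eqv {G} (H : list (fm G)) {s} (a b : tm G s) : Prop := H ||- EqT a b.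

Definition fiff {G} (H : list (fm G)) (A B : fm G) : Prop :=
  H ||- A ==> B /\ H ||- B ==> A.

(** Extensions in the Kripke sense: only the preservation of derivability is recorded, so later
    steps do not depend on how the new context was built. *)
Definition morph {G D} (H : list (fm G)) (H' : list (fm D)) (f : sub G D) : Prop :=
  forall A, H ||- A -> H' ||- sub_fm A f.

Definition ext {G} (H H' : list (fm G)) : Prop := forall A, H ||- A -> H' ||- A.

Lemma shifts_morph {G s} (H : list (fm G)) H' :
  incl (map (shift_fm (s := s)) H) H' -> morph H H' shifts.
Proof. intros I A h; eapply prv_weaken; [exact (prv_sub _ _ h _ shifts) | easy]. Qed.

Lemma cons_ext {G} (H : list (fm G)) A : ext H (A :: H).
Proof. intros B h; eapply prv_weaken; [exact h | now apply incl_tl, incl_refl]. Qed.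

Lemma ext_eqv {G} (H H' : list (fm G)) (l : ext H H') s (a b : tm G s) :
  eqv H a b -> eqv H' a b.
Proof. apply l. Qed.

Lemma morph_eqv {G D} (H : list (fm G)) (H' : list (fm D)) f (m : morph H H' f) s
  (a b : tm G s) : eqv H a b -> eqv H' (sub_tm f a) (sub_tm f b).
Proof. intros h; unfold eqv; rewrite <- sub_EqT; now apply m. Qed.

Lemma sub_fm_scons_0 {G s} (A : fm (s :: G)) :
  sub_fm A (scons (T := tm (s :: G)) #0 shifts) = A.
Proof. rewrite <- sub_fm_ids; apply sub_fm_ext; now apply var_case. Qed.

(** These rules quantify over all extensions of the context and hypotheses
    instead of naming the new ones, so that both remain variables throughout a
    proof and the facts already derived can be transported. *)
Lemma prv_allI {G s} (H : list (fm G)) (A : fm (s :: G)) :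
  (forall D (H' : list (fm D)) f x, morph H H' f -> H' ||- sub_fm A (scons x f)) ->
  H ||- All s A.
Proof.
intros h; apply p_allI; rewrite <- sub_fm_scons_0; apply h.
now apply shifts_morph, incl_refl.
Qed.

Lemma prv_impI {G} (H : list (fm G)) A B :
  (forall H', ext H H' -> H' ||- A -> H' ||- B) -> H ||- A ==> B.
Proof. intros h; apply p_impI, h; [apply cons_ext | apply p_hyp; now left]. Qed.

Lemma prv_orE {G} (H : list (fm G)) A B C : H ||- Or A B ->
  (forall H', ext H H' -> H' ||- A -> H' ||- C) ->
  (forall H', ext H H' -> H' ||- B -> H' ||- C) -> H ||- C.
Proof.
intros h hA hB; eapply p_orE; [exact h | apply hA | apply hB];
  ((apply p_hyp; now left) || apply cons_ext).
Qed.

Lemma prv_exE {G s} (H : list (fm G)) (A : fm (s :: G)) C : H ||- Ex s A ->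
  (forall D (H' : list (fm D)) f x, morph H H' f ->
    H' ||- sub_fm A (scons x f) -> H' ||- sub_fm C f) -> H ||- C.
Proof.
intros h k; eapply p_exE; [exact h|]; apply (k _ _ _ #0).
- now apply shifts_morph, incl_tl, incl_refl.
- rewrite sub_fm_scons_0; apply p_hyp; now left.
Qed.

Lemma prv_ind {G} (H : list (fm G)) (A : fm (N :: G)) : qf A ->
  H ||- inst A Zero ->
  (forall D (H' : list (fm D)) f x, morph H H' f ->
    H' ||- sub_fm A (scons x f) -> H' ||- sub_fm A (scons (Succ @ x) f)) ->
  forall a, H ||- inst A a.
Proof.
intros q h0 hS a; apply p_allE; eapply p_impE;
  [eapply p_impE; [apply p_ax, ax_ind, q | exact h0]|].
apply p_allI, p_impI, hS; [now apply shifts_morph, incl_tl, incl_refl|].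
rewrite sub_fm_scons_0; apply p_hyp; now left.
Qed.

Lemma inst_EqT {G s t} (a b : tm (s :: G) t) c :
  inst (EqT a b) c = EqT (sub_tm (scons c ids) a) (sub_tm (scons c ids) b).
Proof. apply sub_EqT. Qed.

Lemma eqv_fun {G} (H : list (fm G)) s t (f g : tm G (s ~> t)) :
  eqv H f g -> forall a, eqv H (f @ a) (g @ a).
Proof.
intros h a; assert (E := p_allE _ _ _ _ _ a h); rewrite inst_EqT in E; cbn in E.
now rewrite !shift_sub, !sub_scons_shifts, !sub_ids in E.
Qed.

Lemma eqv_funI {G} (H : list (fm G)) s t (f g : tm G (s ~> t)) :
  (forall D (H' : list (fm D)) r x, morph H H' r ->
     eqv H' (sub_tm r f @ x) (sub_tm r g @ x)) -> eqv H f g.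
Proof.
intros h; apply prv_allI; intros D H' r x m; rewrite sub_EqT; cbn.
rewrite !shift_sub, !sub_scons_shifts; now apply h.
Qed.

Global Instance eqv_equiv {G} (H : list (fm G)) s : Equivalence (@eqv G H s).
Proof.
split.
- revert G H; induction s; intros G H a; [apply p_ax, ax_refl|].
  apply eqv_funI; intros; apply IHs2.
- revert G H; induction s; intros G H a b h;
    [eapply p_impE; [apply p_ax, ax_sym | exact h]|].
  apply eqv_funI; intros D H' r x m; apply IHs2, eqv_fun.
  now apply (morph_eqv _ _ _ m).
- revert G H; induction s; intros G H a b c h1 h2;
    [eapply p_impE; [eapply p_impE; [apply p_ax, ax_trans | exact h1] | exact h2]|].
  apply eqv_funI; intros D H' r x m; apply (IHs2 _ _ _ (sub_tm r b @ x));
  apply eqv_fun; now apply (morph_eqv _ _ _ m).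
Qed.

(** Congruence in the function is pointwise; congruence in the argument is the extensionality axiom,
    and it makes rewriting sound at all types. *)
Global Instance App_proper {G} (H : list (fm G)) s t :
  Proper (eqv H ==> eqv H ==> eqv H) (@App G s t).
Proof.
intros f g h a b k; transitivity (g @ a); [now apply eqv_fun|].
eapply p_impE; [apply p_ax, ax_ext | exact k].
Qed.

Global Instance fiff_equiv {G} (H : list (fm G)) : Equivalence (fiff H).
Proof.
split.
- intros A; split; now apply prv_impI.
- intros A B [h k]; now split.
- intros A B C [h1 k1] [h2 k2]; split; apply prv_impI; intros H' l h.
  + now eapply p_impE; [apply l, h2|]; eapply p_impE; [apply l, h1|].
  + now eapply p_impE; [apply l, k1|]; eapply p_impE; [apply l, k2|].
Qed.

Lemma fiffI {G} (H : list (fm G)) A B :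
  (forall H', ext H H' -> H' ||- A -> H' ||- B) ->
  (forall H', ext H H' -> H' ||- B -> H' ||- A) -> fiff H A B.
Proof. intros; split; now apply prv_impI. Qed.

Lemma fiff1 {G} (H H' : list (fm G)) A B : fiff H A B -> ext H H' ->
  H' ||- A -> H' ||- B.
Proof. intros [h k] l; now apply p_impE, l. Qed.

Lemma fiff2 {G} (H H' : list (fm G)) A B : fiff H A B -> ext H H' ->
  H' ||- B -> H' ||- A.
Proof. intros [h k] l; now apply p_impE, l. Qed.

Global Instance prv_proper {G} (H : list (fm G)) :
  Proper (fiff H ==> iff) (prv iRCA G H).
Proof. intros A B [h k]; split; intros; now eapply p_impE; [eassumption|]. Qed.

Global Instance Eq_proper {G} (H : list (fm G)) :
  Proper (eqv H ==> eqv H ==> fiff H) (@Eq G).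
Proof.
intros a b h c d k; apply fiffI; intros H' l e;
  apply (ext_eqv _ _ l) in h, k; change (eqv H' a c) in e || change (eqv H' b d) in e;
  [change (eqv H' b d); now rewrite <- h, <- k | change (eqv H' a c); now rewrite h, k].
Qed.

Global Instance And_proper {G} (H : list (fm G)) :
  Proper (fiff H ==> fiff H ==> fiff H) (@And G).
Proof.
intros A B h C D k; apply fiffI; intros H' l e; apply p_andI.
- apply (fiff1 _ _ _ _ h l); eapply p_andE1; exact e.
- apply (fiff1 _ _ _ _ k l); eapply p_andE2; exact e.
- apply (fiff2 _ _ _ _ h l); eapply p_andE1; exact e.
- apply (fiff2 _ _ _ _ k l); eapply p_andE2; exact e.
Qed.

Global Instance Or_proper {G} (H : list (fm G)) :
  Proper (fiff H ==> fiff H ==> fiff H) (@Or G).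
Proof.
intros A B h C D k; apply fiffI; intros H' l e; apply (prv_orE _ _ _ _ e);
  intros H'' l' e'; assert (l2 : ext H H'') by (intros X x; now apply l', l).
- now apply p_orI1, (fiff1 _ _ _ _ h l2).
- now apply p_orI2, (fiff1 _ _ _ _ k l2).
- now apply p_orI1, (fiff2 _ _ _ _ h l2).
- now apply p_orI2, (fiff2 _ _ _ _ k l2).
Qed.

Global Instance Imp_proper {G} (H : list (fm G)) :
  Proper (fiff H ==> fiff H ==> fiff H) (@Imp G).
Proof.
intros A B h C D k; apply fiffI; intros H' l e; apply prv_impI; intros H'' l' e';
  assert (l2 : ext H H'') by (intros X x; now apply l', l).
- apply (fiff1 _ _ _ _ k l2); eapply p_impE; [apply l', e|].
  now apply (fiff2 _ _ _ _ h l2).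
- apply (fiff2 _ _ _ _ k l2); eapply p_impE; [apply l', e|].
  now apply (fiff1 _ _ _ _ h l2).
Qed.

Lemma eqv_sub {G D t} (H : list (fm D)) (f g : sub G D) (a : tm G t) :
  (forall t v, eqv H (f t v) (g t v)) -> eqv H (sub_tm f a) (sub_tm g a).
Proof. intros E; induction a; cbn; try reflexivity; [apply E | now f_equiv]. Qed.

Lemma eqv_up {G D s} (H : list (fm D)) H' (f g : sub G D) :
  (forall t v, eqv H (f t v) (g t v)) -> morph H H' shifts ->
  forall t v, eqv H' (up (s := s) f t v) (up g t v).
Proof.
intros E m; apply var_case; [reflexivity|]; intros t v; cbn.
rewrite !shift_sub; now apply (morph_eqv _ _ _ m).
Qed.

Lemma inst_up_shifts {G s} (A : fm (s :: G)) : inst (sub_fm A (up shifts)) #0 = A.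
Proof.
unfold inst; rewrite sub_sub_fm; rewrite <- sub_fm_ids; apply sub_fm_ext.
now apply var_case.
Qed.

(** The [Proper] instances cover connectives but not quantifiers; replacement of equals inside a
    quantified or unknown formula goes through this lemma. *)
Lemma leibniz {G} (A : fm G) : forall D (H : list (fm D)) (f g : sub G D),
  (forall t v, eqv H (f t v) (g t v)) -> fiff H (sub_fm A f) (sub_fm A g).
Proof.
enough (K : forall D (H : list (fm D)) (f g : sub G D),
  (forall t v, eqv H (f t v) (g t v)) -> H ||- sub_fm A f -> H ||- sub_fm A g).
{ intros D H f g E; apply fiffI; intros H' l; apply K; intros t v;
    [|symmetry]; apply (ext_eqv _ _ l), E. }
induction A; intros D H f g E e; cbn in *.
- assert (E1 := eqv_sub H f g t E); assert (E2 := eqv_sub H f g t0 E).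
  rewrite E1, E2 in e; exact e.
- exact e.
- apply p_andI; [apply (IHA1 _ _ f), (p_andE1 _ _ _ _ _ e) |
                 apply (IHA2 _ _ f), (p_andE2 _ _ _ _ _ e)]; auto.
- apply (prv_orE _ _ _ _ e); intros H' l e';
    [apply p_orI1, (IHA1 _ _ f) | apply p_orI2, (IHA2 _ _ f)]; auto;
    intros; now apply (ext_eqv _ _ l).
- apply prv_impI; intros H' l e'; apply (IHA2 _ _ f);
    [intros; now apply (ext_eqv _ _ l)|].
  eapply p_impE; [apply l, e|]; apply (IHA1 _ _ g); auto.
  intros; symmetry; now apply (ext_eqv _ _ l).
- apply p_allI, (IHA _ _ (up f)).
  + now apply (eqv_up H); [|apply shifts_morph, incl_refl].
  + assert (e' := shifts_morph (s := s) H _ (incl_refl _) _ e); cbn in e'.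
    apply (p_allE _ _ _ _ _ #0) in e'; now rewrite inst_up_shifts in e'.
- eapply p_exE; [exact e|]; cbn; apply (p_exI _ _ _ _ _ #0).
  cbn; rewrite inst_up_shifts; apply (IHA _ _ (up f)); [|apply p_hyp; now left].
  now apply (eqv_up H); [|now apply shifts_morph, incl_tl, incl_refl].
Qed.

(** Stated under a pending substitution because one beta step leaves an inner abstraction in the
    form [sub_tm] of a [lam], to which the lemma applies again. *)
Lemma beta_sub {G D s t} (H : list (fm D)) (a : tm (s :: G) t) (f : sub G D) b :
  eqv H (sub_tm f (lam a) @ b) (sub_tm (scons b f) a).
Proof.
assert (P : forall t (c : tm D t), eqv H (Pi @ c @ b) c)
  by (intros; apply p_ax, ax_Pi).
induction a; cbn; try apply P.
- revert s0 v; apply var_case; [|intros; apply P]; cbn.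
  transitivity (Pi @ b @ (Pi (t := s ~> s) @ b)); [apply p_ax, ax_Sg|].
  apply p_ax, ax_Pi.
- etransitivity; [apply p_ax, ax_Sg|]; now f_equiv.
Qed.

(** * Closed terms and rewriting tactics *)

Lemma sub_num {G D} (f : sub G D) k : sub_tm f (num k) = num k.
Proof. induction k; cbn; congruence. Qed.

Definition nosub {G} : sub [] G := fun t v => match v with end.
(** Bracket abstraction commutes with substitution only up to provable equality,
    so abstractions are taken of terms without parameters, which substitution
    leaves unchanged. *)
Definition cl {G t} (a : tm [] t) : tm G t := sub_tm nosub a.

Lemma sub_cl {G D t} (f : sub G D) (a : tm [] t) : sub_tm f (cl a) = cl a.
Proof. unfold cl; rewrite sub_sub_tm; apply sub_tm_ext; now intros u v. Qed.

Lemma beta1 {G s t} (H : list (fm G)) (a : tm [s] t) x :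
  eqv H (cl (lam a) @ x) (sub_tm (scons x nosub) a).
Proof. apply beta_sub. Qed.

Lemma beta2 {G s1 s t} (H : list (fm G)) (a : tm [s; s1] t) x1 x :
  eqv H (cl (lam (lam a)) @ x1 @ x) (sub_tm (scons x (scons x1 nosub)) a).
Proof. rewrite beta1; apply beta_sub. Qed.

Lemma beta3 {G s2 s1 s t} (H : list (fm G)) (a : tm [s; s1; s2] t) x2 x1 x :
  eqv H (cl (lam (lam (lam a))) @ x2 @ x1 @ x)
    (sub_tm (scons x (scons x1 (scons x2 nosub))) a).
Proof. rewrite beta2; apply beta_sub. Qed.

Lemma beta4 {G s3 s2 s1 s t} (H : list (fm G)) (a : tm [s; s1; s2; s3] t) x3 x2 x1 x :
  eqv H (cl (lam (lam (lam (lam a)))) @ x3 @ x2 @ x1 @ x)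
    (sub_tm (scons x (scons x1 (scons x2 (scons x3 nosub)))) a).
Proof. rewrite beta3; apply beta_sub. Qed.

Lemma rec_0 {G} (H : list (fm G)) b c : eqv H (Rec @ Zero @ b @ c) b.
Proof. apply p_ax, ax_Rec0. Qed.

Lemma rec_S {G} (H : list (fm G)) a b c :
  eqv H (Rec @ (Succ @ a) @ b @ c) (c @ (Rec @ a @ b @ c) @ a).
Proof. apply p_ax, ax_RecS. Qed.

Lemma primrec_0 {G} (H : list (fm G)) b step : eqv H (primrec Zero b step) b.
Proof. apply rec_0. Qed.

Lemma primrec_S {G} (H : list (fm G)) a b step :
  eqv H (primrec (Succ @ a) b step)
    (sub_tm (scons a (scons (primrec a b step) ids)) step).
Proof.
(* The identity substitution is inserted to give the step term the shape that [beta_sub] expects. *)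
unfold primrec at 1; rewrite rec_S, <- (sub_ids (lam _)) at 1.
rewrite beta_sub; cbn; apply beta_sub.
Qed.

Lemma sub_pred {G D} (f : sub G D) x : sub_tm f (pred x) = pred (sub_tm f x).
Proof. reflexivity. Qed.
Lemma sub_add {G D} (f : sub G D) x y :
  sub_tm f (add x y) = add (sub_tm f x) (sub_tm f y).
Proof. reflexivity. Qed.
Lemma sub_monus {G D} (f : sub G D) x y :
  sub_tm f (monus x y) = monus (sub_tm f x) (sub_tm f y).
Proof. reflexivity. Qed.
Lemma sub_tri {G D} (f : sub G D) x : sub_tm f (tri x) = tri (sub_tm f x).
Proof. reflexivity. Qed.
Lemma sub_pi2 {G D} (f : sub G D) x : sub_tm f (pi2 x) = pi2 (sub_tm f x).
Proof. reflexivity. Qed.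
Lemma sub_pi1 {G D} (f : sub G D) x : sub_tm f (pi1 x) = pi1 (sub_tm f x).
Proof. reflexivity. Qed.
Lemma sub_Le {G D} (f : sub G D) x y :
  sub_fm (Le x y) f = Le (sub_tm f x) (sub_tm f y).
Proof. reflexivity. Qed.
Lemma sub_Lt {G D} (f : sub G D) x y :
  sub_fm (Lt x y) f = Lt (sub_tm f x) (sub_tm f y).
Proof. reflexivity. Qed.
Lemma sub_Not {G D} (f : sub G D) (A : fm G) : sub_fm (Not A) f = Not (sub_fm A f).
Proof. reflexivity. Qed.

Global Instance pred_proper {G} (H : list (fm G)) :
  Proper (eqv H ==> eqv H) (@pred G).
Proof. intros a b h; unfold pred, primrec; now rewrite h. Qed.
Global Instance add_proper {G} (H : list (fm G)) :
  Proper (eqv H ==> eqv H ==> eqv H) (@add G).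
Proof. intros a b h c d k; unfold add, primrec; now rewrite h, k. Qed.
Global Instance monus_proper {G} (H : list (fm G)) :
  Proper (eqv H ==> eqv H ==> eqv H) (@monus G).
Proof. intros a b h c d k; unfold monus, primrec; now rewrite h, k. Qed.
Global Instance tri_proper {G} (H : list (fm G)) :
  Proper (eqv H ==> eqv H) (@tri G).
Proof. intros a b h; unfold tri, primrec; now rewrite h. Qed.
Global Instance pi2_proper {G} (H : list (fm G)) :
  Proper (eqv H ==> eqv H) (@pi2 G).
Proof. intros a b h; unfold pi2, primrec; now rewrite h. Qed.
Global Instance Le_proper {G} (H : list (fm G)) :
  Proper (eqv H ==> eqv H ==> fiff H) (@Le G).
Proof. intros a b h c d k; unfold Le; now rewrite h, k. Qed.
Global Instance Lt_proper {G} (H : list (fm G)) :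
  Proper (eqv H ==> eqv H ==> fiff H) (@Lt G).
Proof. intros a b h c d k; unfold Lt; now rewrite h, k. Qed.
Global Instance Not_proper {G} (H : list (fm G)) :
  Proper (fiff H ==> fiff H) (@Not G).
Proof. intros A B h; unfold Not; now rewrite h. Qed.

Lemma shifts_Var {G s t} (v : var G t) : @shifts G s t v = Var (vs v).
Proof. reflexivity. Qed.
Lemma ids_Var {G t} (v : var G t) : @ids G t v = Var v.
Proof. reflexivity. Qed.

#[global] Hint Rewrite @shifts_Var @ids_Var @sub_num @sub_cl @sub_pred @sub_add
  @sub_monus @sub_tri @sub_pi2 @sub_pi1 @sub_Le @sub_Lt @sub_Not @shift_sub @sub_scons_shifts @sub_up_shifts
  @sub_ids : sb.

Ltac fold_eqv :=
  repeat match goal with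
  | |- prv iRCA _ ?H (Eq ?a ?b) => change (eqv H a b)
  | h : prv iRCA _ ?H (Eq ?a ?b) |- _ => change (eqv H a b) in h
  end.

Ltac sb := unfold inst;
  repeat (progress (cbn [sub_fm sub_tm scons up]; autorewrite with sb)); fold_eqv.
Ltac sb_in h := unfold inst in h;
  repeat (progress (cbn [sub_fm sub_tm scons up] in h; autorewrite with sb in h)).

Ltac lift_ext l :=
  match type of l with ext ?H ?H' =>
    repeat match goal with
    | h : prv iRCA _ H _ |- _ => apply l in h
    | h : eqv H _ _ |- _ => apply (ext_eqv _ _ l) in h
    end; clear l; try (clear H; rename H' into H)
  end.

(** Transports all derived facts along [m], then generalizes each substituted term under its old
    name, so that a script continues as if the context had not changed. *)
Ltac lift_morph m :=
  match type of m with @morph ?G ?D ?H ?H' ?f =>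
    repeat match goal with
    | h : prv iRCA _ H _ |- _ => apply m in h; sb_in h
    | h : eqv H _ _ |- _ => apply (morph_eqv _ _ _ m) in h; sb_in h
    end; fold_eqv; clear m; unfold one in *;
    repeat match goal with
    | a : tm G ?t |- _ =>
      let a' := fresh a in set (a' := sub_tm f a) in *; clearbody a'; clear a;
      rename a' into a
    end;
    try (clear f); try (clear H; rename H' into H); try (clear G; rename D into G)
  end.

(** The motive is recovered by weakening the goal, normalizing it and abstracting the weakened [x];
    [repeat constructor] then checks that it is quantifier-free. *)
Ltac induct x :=
  try match goal with |- eqv ?H ?a ?b => change (prv iRCA _ H (Eq a b)) end;
  match goal with |- prv iRCA ?G ?H ?F =>
    let B := fresh "B" in let E := fresh "E" in
    evar (B : fm (N :: G));
    assert (E : sub_fm F (shifts (s := N)) = B) by (subst B; sb; reflexivity);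
    let F' := eval unfold B in B in
    clear E B;
    match eval pattern (sub_tm (@shifts G N) x) in F' with ?P _ =>
      let A := eval cbv beta in (P #0) in
      replace F with (inst A x) by (sb; reflexivity)
    end;
    let D := fresh "D" in let H' := fresh "H'" in let f := fresh "Hsub" in
    let n := fresh "n" in let m := fresh "Hmor" in let IH := fresh "IH" in
    apply prv_ind;
    [ repeat constructor
    | sb
    | intros D H' f n m IH; sb; sb_in IH; fold_eqv; lift_morph m;
      try (clear x; rename n into x) ]
  end.

Lemma pred_0 {G} (H : list (fm G)) : eqv H (pred Zero) Zero.
Proof. exact (primrec_0 H _ _). Qed.
Lemma pred_S {G} (H : list (fm G)) x : eqv H (pred (Succ @ x)) x.
Proof. exact (primrec_S H x Zero #0). Qed.
Lemma add_0 {G} (H : list (fm G)) x : eqv H (add x Zero) x.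
Proof. exact (primrec_0 H _ _). Qed.
Lemma add_S {G} (H : list (fm G)) x y : eqv H (add x (Succ @ y)) (Succ @ add x y).
Proof. exact (primrec_S H y x (Succ @ #1)). Qed.
Lemma monus_0 {G} (H : list (fm G)) x : eqv H (monus x Zero) x.
Proof. exact (primrec_0 H _ _). Qed.
Lemma monus_S {G} (H : list (fm G)) x y : eqv H (monus x (Succ @ y)) (pred (monus x y)).
Proof. exact (primrec_S H y x (pred #1)). Qed.
Lemma tri_0 {G} (H : list (fm G)) : eqv H (tri Zero) Zero.
Proof. exact (primrec_0 H _ _). Qed.
Lemma tri_S {G} (H : list (fm G)) x : eqv H (tri (Succ @ x)) (add (tri x) x).
Proof. exact (primrec_S H x Zero (add #1 #0)). Qed.
Lemma pi2_0 {G} (H : list (fm G)) : eqv H (pi2 Zero) (num 1).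
Proof. exact (primrec_0 H _ _). Qed.
Lemma pi2_S {G} (H : list (fm G)) x : eqv H (pi2 (Succ @ x))
   (add (pi2 x) (monus (num 1) (monus (tri (Succ @ pi2 x)) (Succ @ x)))).
Proof. exact (primrec_S H x (num 1) _). Qed.

Lemma monus_0l {G} (H : list (fm G)) x : eqv H (monus Zero x) Zero.
Proof. induct x; [apply monus_0 |]. now rewrite monus_S, IH, pred_0. Qed.
Lemma monus_SS {G} (H : list (fm G)) x y :
  eqv H (monus (Succ @ x) (Succ @ y)) (monus x y).
Proof.
induct y.
- now rewrite monus_S, !monus_0, pred_S.
- now rewrite monus_S, IH, <- monus_S.
Qed.

(** * Elementary arithmetic *)

Lemma monus_diag {G} (H : list (fm G)) x : eqv H (monus x x) Zero.
Proof. induct x; [apply monus_0|]. now rewrite monus_SS. Qed.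

(** Naming the predecessor instead of asserting that one exists keeps the formula within
    quantifier-free induction. *)
Lemma zero_or_pred {G} (H : list (fm G)) x : H ||- Or (x =0 Zero) (x =0 Succ @ pred x).
Proof.
induct x.
- apply p_orI1; fold_eqv; reflexivity.
- apply p_orI2; fold_eqv; now rewrite pred_S.
Qed.

Lemma prv_zcase {G} (H : list (fm G)) x C :
  (forall H', ext H H' -> eqv H' x Zero -> H' ||- C) ->
  (forall H' y, ext H H' -> eqv H' x (Succ @ y) -> H' ||- C) -> H ||- C.
Proof.
intros h0 hS; apply (prv_orE _ _ _ _ (zero_or_pred H x)); auto.
intros H' l h; exact (hS H' (pred x) l h).
Qed.

Ltac raw :=
  try match goal with
  | |- @eqv ?G ?H _ ?a ?b => change (@prv iRCA G H (Eq a b))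
  end.

Tactic Notation "zcase" constr(x) "as" ident(h) ident(y) :=
  raw; apply (prv_zcase _ x);
  [ let H' := fresh "H'" in let l := fresh "Hext" in
    intros H' l h; lift_ext l; fold_eqv
  | let H' := fresh "H'" in let l := fresh "Hext" in
    intros H' y l h; lift_ext l; fold_eqv ].

Tactic Notation "orcase" constr(p) "as" ident(h) :=
  raw; apply (prv_orE _ _ _ _ p);
  let H' := fresh "H'" in let l := fresh "Hext" in
  intros H' l h; lift_ext l; fold_eqv.

Tactic Notation "pintro" ident(h) :=
  unfold Not; apply prv_impI;
  let H' := fresh "H'" in let l := fresh "Hext" in intros H' l h; lift_ext l; fold_eqv.

Tactic Notation "pall" ident(x) :=
  apply prv_allI;
  let D := fresh "D" in let H' := fresh "H'" in let f := fresh "Hsub" in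
  let m := fresh "Hmor" in intros D H' f x m; sb; lift_morph m.

(** Induction on [i], with [n - m] truncated, for
    [A(a - (b - i), b - (b - i))]. *)
Lemma prv_dind {G} (H : list (fm G)) (A : fm (N :: N :: G)) : qf A ->
  (forall D (H' : list (fm D)) f y, morph H H' f ->
     H' ||- sub_fm A (scons Zero (scons y f))) ->
  (forall D (H' : list (fm D)) f x, morph H H' f ->
     H' ||- sub_fm A (scons x (scons Zero f))) ->
  (forall D (H' : list (fm D)) f x y, morph H H' f ->
     H' ||- sub_fm A (scons x (scons y f)) ->
     H' ||- sub_fm A (scons (Succ @ x) (scons (Succ @ y) f))) ->
  forall a b, H ||- sub_fm A (scons a (scons b ids)).
Proof.
intros q h1 h2 hS a b.
assert (cong : forall D (H' : list (fm D)) f x x' y y', eqv H' x x' -> eqv H' y y' ->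
  H' ||- sub_fm A (scons x (scons y f)) -> H' ||- sub_fm A (scons x' (scons y' f))).
{ intros D H' f x x' y y' hx hy h; eapply fiff1; [apply leibniz| |exact h];
    [|intros X hX; exact hX]; apply var_case; [easy|]; apply var_case; [easy|reflexivity]. }
assert (mi : morph H H ids) by (intros X; now rewrite sub_fm_ids).
set (B := sub_fm A (scons (monus (shift a) (monus (shift b) #0))
  (scons (monus (shift b) (monus (shift b) #0)) (@shifts G N)))).
assert (EB : forall D (f : sub G D) c, sub_fm B (scons c f) =
  sub_fm A (scons (monus (sub_tm f a) (monus (sub_tm f b) c))
    (scons (monus (sub_tm f b) (monus (sub_tm f b) c)) f))).
{ intros D f c; unfold B; rewrite sub_sub_fm; apply sub_fm_ext.
  apply var_case; [now sb|]; apply var_case; [now sb|easy]. }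
assert (K : H ||- inst B b); [apply prv_ind|].
- now apply sub_qf.
- unfold inst; rewrite EB, !sub_ids.
  generalize (h2 _ _ _ (monus a b) mi); apply cong; rewrite ?monus_diag; rewrite monus_0;
    [reflexivity | now rewrite monus_diag].
- intros D H' f c m; rewrite !EB; intros IH.
  generalize dependent (sub_tm f b); intros b' IH; set (a' := sub_tm f a) in *; clearbody a'.
  apply (prv_zcase _ (monus b' c)).
  (* Once [b' - c] is zero, raising [c] no longer changes the arguments. *)
  + intros H'' l e; apply l in IH; revert IH; apply cong;
      now rewrite monus_S, e, pred_0.
  + intros H'' d l e; apply l in IH.
    assert (m' : morph H H'' f) by (intros X x; now apply l, m).
    assert (E : eqv H'' (monus b' (Succ @ c)) d) by now rewrite monus_S, e, pred_S.
    apply (cong _ _ f (monus a' d) _ (monus b' d)); [now rewrite E..|].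
    (* Otherwise raising [c] by one raises both arguments by one, except where an argument is still
       truncated to 0, and there a base case applies. *)
    apply (cong _ _ _ _ (pred (monus a' d)) _ (pred (monus b' d))) in IH;
      [|now rewrite e, monus_S..].
    apply (prv_zcase _ (monus a' d)).
    * intros H3 l3 e3; apply (cong _ _ f Zero _ (monus b' d)); [easy..|].
      apply h1; intros X x; now apply l3, m'.
    * intros H3 u l3 e3; apply l3 in IH; apply (prv_zcase _ (monus b' d)).
      -- intros H4 l4 e4; apply (cong _ _ f (monus a' d) _ Zero); [easy..|].
         apply h2; intros X x; now apply l4, l3, m'.
      -- intros H4 v l4 e4; apply l4 in IH; apply (ext_eqv _ _ l4) in e3.
         apply (cong _ _ f (Succ @ u) _ (Succ @ v)); [easy..|].
         apply hS; [intros X x; now apply l4, l3, m'|].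
         revert IH; apply cong; [now rewrite e3, pred_S | now rewrite e4, pred_S].
- revert K; unfold inst; rewrite EB; apply cong; sb; now rewrite monus_diag, monus_0.
Qed.

Ltac dinduct x y :=
  raw;
  match goal with |- prv iRCA ?G ?H ?F =>
    let B := fresh "B" in let E := fresh "E" in
    evar (B : fm (N :: N :: G));
    assert (E : sub_fm (sub_fm F (shifts (s := N))) (shifts (s := N)) = B)
      by (subst B; sb; reflexivity);
    let F' := eval unfold B in B in
    clear E B;
    match eval pattern (sub_tm (@shifts (N :: G) N) (sub_tm (@shifts G N) x)),
      (sub_tm (@shifts (N :: G) N) (sub_tm (@shifts G N) y)) in F' with ?P _ _ =>
      let A := eval cbv beta in (P #0 #1) in
      replace F with (sub_fm A (scons x (scons y ids))) by (sb; reflexivity)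
    end;
    let D := fresh "D" in let H' := fresh "H'" in let f := fresh "Hsub" in
    let n := fresh "n" in let k := fresh "k" in
    let m := fresh "Hmor" in let IH := fresh "IH" in
    apply prv_dind;
    [ repeat constructor
    | intros D H' f n m; sb; lift_morph m;
      try (clear x); try (clear y; rename n into y)
    | intros D H' f n m; sb; lift_morph m;
      try (clear y); try (clear x; rename n into x)
    | intros D H' f n k m IH; sb; sb_in IH; fold_eqv; lift_morph m;
      try (clear x; rename n into x); try (clear y; rename k into y) ]
  end.

Lemma Succ_0_absurd {G} (H : list (fm G)) A x : eqv H (Succ @ x) Zero -> H ||- A.
Proof. intros h; apply p_botE; eapply p_impE; [apply p_ax, ax_succ_nz|exact h]. Qed.

Lemma Le_SS {G} (H : list (fm G)) x y : fiff H (Le (Succ @ x) (Succ @ y)) (Le x y).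
Proof. unfold Le; now rewrite monus_SS. Qed.
Lemma Lt_SS {G} (H : list (fm G)) x y : fiff H (Lt (Succ @ x) (Succ @ y)) (Lt x y).
Proof. apply Le_SS. Qed.
Lemma Lt_S_Le {G} (H : list (fm G)) x y : fiff H (Lt x (Succ @ y)) (Le x y).
Proof. apply Le_SS. Qed.
Lemma Le_0l {G} (H : list (fm G)) x : H ||- Le Zero x.
Proof. apply monus_0l. Qed.
Lemma Le_refl {G} (H : list (fm G)) x : H ||- Le x x.
Proof. apply monus_diag. Qed.
Lemma Le_0r {G} (H : list (fm G)) x : H ||- Le x Zero -> eqv H x Zero.
Proof. unfold Le; fold_eqv; intros h; now rewrite monus_0 in h. Qed.
Lemma Lt_0r {G} (H : list (fm G)) x A : H ||- Lt x Zero -> H ||- A.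
Proof. intros h; apply (Succ_0_absurd _ _ x), Le_0r, h. Qed.
Lemma Lt_0_S {G} (H : list (fm G)) x : H ||- Lt Zero (Succ @ x).
Proof. rewrite Lt_S_Le; apply Le_0l. Qed.

Lemma Lt_or_Le {G} (H : list (fm G)) x y : H ||- Or (Lt x y) (Le y x).
Proof.
dinduct x y.
- zcase y as h u; rewrite h; [apply p_orI2, Le_refl | apply p_orI1, Lt_0_S].
- apply p_orI2, Le_0l.
- now rewrite Lt_SS, Le_SS.
Qed.

Lemma Le_antisym {G} (H : list (fm G)) x y : H ||- Le x y ==> Le y x ==> x =0 y.
Proof.
dinduct x y.
- pintro h; pintro k; symmetry; now apply Le_0r.
- pintro h; pintro k; now apply Le_0r.
- rewrite !Le_SS; pintro p; pintro q.
  assert (E := p_impE _ _ _ _ _ (p_impE _ _ _ _ _ IH p) q); fold_eqv; now rewrite E.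
Qed.

Lemma add_Sl {G} (H : list (fm G)) x y : eqv H (add (Succ @ x) y) (Succ @ add x y).
Proof. induct y; [now rewrite !add_0 | now rewrite !add_S, IH]. Qed.
Lemma add_0l {G} (H : list (fm G)) x : eqv H (add Zero x) x.
Proof. induct x; [now rewrite !add_0 | now rewrite !add_S, IH]. Qed.
Lemma add_comm {G} (H : list (fm G)) x y : eqv H (add x y) (add y x).
Proof. induct y; [now rewrite add_0, add_0l | now rewrite add_S, add_Sl, IH]. Qed.
Lemma add_assoc {G} (H : list (fm G)) x y z :
  eqv H (add x (add y z)) (add (add x y) z).
Proof. induct z; [now rewrite !add_0 | now rewrite !add_S, IH]. Qed.
Lemma add_monus {G} (H : list (fm G)) x y : eqv H (monus (add x y) x) y.
Proof. induct x; [now rewrite add_0l, monus_0 | now rewrite add_Sl, monus_SS]. Qed.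

Lemma Le_add {G} (H : list (fm G)) x y : H ||- Le x (add x y).
Proof. induct x; [apply Le_0l | now rewrite add_Sl, Le_SS]. Qed.
Lemma Le_diff {G} (H : list (fm G)) x y : H ||- Le x y ==> y =0 add x (monus y x).
Proof.
dinduct x y.
- pintro h; now rewrite add_0l, monus_0.
- pintro h; apply Le_0r in h; now rewrite h, add_0l, monus_0.
- rewrite Le_SS, add_Sl, monus_SS; pintro h.
  assert (E := p_impE _ _ _ _ _ IH h); fold_eqv; now rewrite <- E.
Qed.

Lemma Le_antisym_eqv {G} (H : list (fm G)) x y :
  H ||- Le x y -> H ||- Le y x -> eqv H x y.
Proof. intros h k; exact (p_impE _ _ _ _ _ (p_impE _ _ _ _ _ (Le_antisym H x y) h) k). Qed.
Lemma Le_elim {G} (H : list (fm G)) x y :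
  H ||- Le x y -> eqv H y (add x (monus y x)).
Proof. intros h; exact (p_impE _ _ _ _ _ (Le_diff H x y) h). Qed.
Lemma Le_trans {G} (H : list (fm G)) x y z :
  H ||- Le x y -> H ||- Le y z -> H ||- Le x z.
Proof.
intros h k; apply Le_elim in h, k; rewrite k, h, <- add_assoc; apply Le_add.
Qed.
Lemma Le_S {G} (H : list (fm G)) x : H ||- Le x (Succ @ x).
Proof. now rewrite <- (add_0 H x) at 2; rewrite <- add_S; apply Le_add. Qed.
Lemma Lt_Le {G} (H : list (fm G)) x y : H ||- Lt x y -> H ||- Le x y.
Proof. intros h; apply (Le_trans _ _ (Succ @ x)); [apply Le_S | exact h]. Qed.
Lemma Lt_Le_trans {G} (H : list (fm G)) x y z :
  H ||- Lt x y -> H ||- Le y z -> H ||- Lt x z.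
Proof. apply Le_trans. Qed.
Lemma Le_Lt_trans {G} (H : list (fm G)) x y z :
  H ||- Le x y -> H ||- Lt y z -> H ||- Lt x z.
Proof. intros h k; apply (Le_trans _ _ (Succ @ y)); [now unfold Lt; rewrite Le_SS | exact k]. Qed.
Lemma Lt_irrefl {G} (H : list (fm G)) x : H ||- Not (Lt x x).
Proof. induct x; [pintro h; exact (Lt_0r _ _ _ h) | now rewrite Lt_SS]. Qed.
Lemma Lt_Le_absurd {G} (H : list (fm G)) x y A :
  H ||- Lt x y -> H ||- Le y x -> H ||- A.
Proof.
intros h k; apply p_botE; eapply p_impE; [apply (Lt_irrefl _ x)|].
now apply (Lt_Le_trans _ _ y).
Qed.
Lemma Lt_0_elim {G} (H : list (fm G)) x : H ||- Lt Zero x -> eqv H x (Succ @ pred x).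
Proof.
intros h; zcase x as e y; [|now rewrite e, pred_S].
rewrite e in h; exact (Lt_0r _ _ _ h).
Qed.
Lemma Lt_0_neq {G} (H : list (fm G)) x : fiff H (Lt Zero x) (Not (x =0 Zero)).
Proof.
apply fiffI; intros H' _ h.
- pintro e; rewrite e in h; exact (Lt_0r _ _ _ h).
- zcase x as e y; [|rewrite e; apply Lt_0_S].
  apply p_botE; eapply p_impE; [exact h | exact e].
Qed.
Lemma Lt_neq {G} (H : list (fm G)) x y : H ||- Lt x y -> H ||- Not (x =0 y).
Proof. intros h; pintro e; rewrite e in h; now apply (Lt_Le_absurd _ _ _ _ h), Le_refl. Qed.
Lemma Le_cases {G} (H : list (fm G)) x y : H ||- Le x y -> H ||- Or (Lt x y) (x =0 y).
Proof.
intros h; orcase (Lt_or_Le H x y) as k; [now apply p_orI1|].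
apply p_orI2; now apply Le_antisym_eqv.
Qed.
Lemma Le_pred {G} (H : list (fm G)) x y : H ||- Le x y -> H ||- Le (pred x) (pred y).
Proof.
intros h; zcase x as e u; [rewrite e, pred_0; apply Le_0l|].
rewrite e in h; assert (k := Lt_0_elim _ _ (Le_Lt_trans _ _ _ _ (Le_0l _ u) h)).
rewrite k, Le_SS in h; now rewrite e, pred_S.
Qed.
Lemma Le_monus {G} (H : list (fm G)) x y z :
  H ||- Le x y -> H ||- Le (monus x z) (monus y z).
Proof.
intros h; induct z; [now rewrite !monus_0|].
now rewrite !monus_S; apply Le_pred.
Qed.
Lemma Le_add_mono {G} (H : list (fm G)) x y z :
  H ||- Le x y -> H ||- Le (add z x) (add z y).
Proof. intros h; apply Le_elim in h; rewrite h, add_assoc; apply Le_add. Qed.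

(** * Bounded search and the pairing function *)

(** The constant step is written with two [Pi] instead of an abstraction around [b], so that
    substitution commutes with it by computation. *)
Definition ifz {G} (c a b : tm G N) : tm G N := Rec @ c @ a @ (Pi @ (Pi @ b)).

Lemma ifz_0 {G} (H : list (fm G)) a b : eqv H (ifz Zero a b) a.
Proof. apply rec_0. Qed.
Lemma ifz_S {G} (H : list (fm G)) c a b : eqv H (ifz (Succ @ c) a b) b.
Proof.
unfold ifz; rewrite rec_S; transitivity (Pi (t := N) @ b @ c); [|apply p_ax, ax_Pi].
f_equiv; apply p_ax, (ax_Pi _ (N ~> N)).
Qed.
Lemma sub_ifz {G D} (f : sub G D) c a b :
  sub_tm f (ifz c a b) = ifz (sub_tm f c) (sub_tm f a) (sub_tm f b).
Proof. reflexivity. Qed.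
Global Instance ifz_proper {G} (H : list (fm G)) :
  Proper (eqv H ==> eqv H ==> eqv H ==> eqv H) (@ifz G).
Proof. intros a b h c d k a' b' h'; unfold ifz; now rewrite h, k, h'. Qed.
#[global] Hint Rewrite @sub_ifz : sb.

(** Positive exactly when [p] has no zero below [s]. *)
Definition allnz {G} (p : tm G one) (s : tm G N) : tm G N :=
  Rec @ s @ num 1 @ (cl (lam (s := one) (lam (lam (ifz (#2 @ #0) Zero #1)))) @ p).
(** The largest zero of [p] below [s] if there is one, and 0 by default. *)
Definition wit {G} (p : tm G one) (s : tm G N) : tm G N :=
  Rec @ s @ Zero @ (cl (lam (s := one) (lam (lam (ifz (#2 @ #0) #0 #1)))) @ p).

Lemma sub_allnz {G D} (f : sub G D) p s :
  sub_tm f (allnz p s) = allnz (sub_tm f p) (sub_tm f s).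
Proof. unfold allnz; sb; reflexivity. Qed.
Lemma sub_wit {G D} (f : sub G D) p s :
  sub_tm f (wit p s) = wit (sub_tm f p) (sub_tm f s).
Proof. unfold wit; sb; reflexivity. Qed.
#[global] Hint Rewrite @sub_allnz @sub_wit : sb.
Global Instance allnz_proper {G} (H : list (fm G)) :
  Proper (eqv H ==> eqv H ==> eqv H) (@allnz G).
Proof. intros a b h c d k; unfold allnz; now rewrite h, k. Qed.
Lemma allnz_0 {G} (H : list (fm G)) p : eqv H (allnz p Zero) (num 1).
Proof. apply rec_0. Qed.
Lemma allnz_S {G} (H : list (fm G)) p s :
  eqv H (allnz p (Succ @ s)) (ifz (p @ s) Zero (allnz p s)).
Proof. unfold allnz at 1; rewrite rec_S, beta3; sb; reflexivity. Qed.
Lemma wit_S {G} (H : list (fm G)) p s :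
  eqv H (wit p (Succ @ s)) (ifz (p @ s) s (wit p s)).
Proof. unfold wit at 1; rewrite rec_S, beta3; sb; reflexivity. Qed.

(** The premises depend on [s], so they must be part of the induction formula; [allnz_elim] is the
    usable rule. *)
Lemma allnz_elim_imp {G} (H : list (fm G)) p s t :
  H ||- Lt Zero (allnz p s) ==> Lt t s ==> Lt Zero (p @ t).
Proof.
induct s; pintro h; pintro k.
- exact (Lt_0r _ _ _ k).
- rewrite allnz_S in h; zcase (p @ s) as e u.
  + rewrite e, ifz_0 in h; exact (Lt_0r _ _ _ h).
  + rewrite e, ifz_S in h; rewrite Lt_S_Le in k; apply Le_cases in k.
    orcase k as k'.
    * exact (p_impE _ _ _ _ _ (p_impE _ _ _ _ _ IH h) k').
    * rewrite k', e; apply Lt_0_S.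
Qed.

Lemma allnz_elim {G} (H : list (fm G)) p s t :
  H ||- Lt Zero (allnz p s) -> H ||- Lt t s -> H ||- Lt Zero (p @ t).
Proof. intros h k; exact (p_impE _ _ _ _ _ (p_impE _ _ _ _ _ (allnz_elim_imp H p s t) h) k). Qed.

Lemma allnz_intro {G} (H : list (fm G)) p s :
  H ||- All N (Lt #0 (shift s) ==> Lt Zero (shift p @ #0)) ->
  H ||- Lt Zero (allnz p s).
Proof.
intros h; enough (K : H ||- Le s s ==> Lt Zero (allnz p s))
  by (exact (p_impE _ _ _ _ _ K (Le_refl _ _))).
(* The bound [s] stays fixed while the induction runs over [t] up to [s]: the quantified hypothesis
   about [s] cannot enter a quantifier-free induction formula. *)
assert (K : forall t, H ||- Le t s ==> Lt Zero (allnz p t)); [|apply K].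
intros t; induct t; pintro k.
- rewrite allnz_0; apply Lt_0_S.
- apply (p_allE _ _ _ _ _ t) in h; sb_in h.
  assert (e := Lt_0_elim _ _ (p_impE _ _ _ _ _ h k)).
  rewrite allnz_S, e, ifz_S.
  exact (p_impE _ _ _ _ _ IH (Lt_Le _ _ _ k)).
Qed.

Lemma allnz_wit_imp {G} (H : list (fm G)) p s :
  H ||- allnz p s =0 Zero ==> p @ wit p s =0 Zero.
Proof.
induct s; pintro h.
- rewrite allnz_0 in h; exact (Succ_0_absurd _ _ _ h).
- rewrite allnz_S in h; rewrite wit_S; zcase (p @ s) as e u.
  + now rewrite e, ifz_0.
  + rewrite e, ifz_S in h; rewrite e, ifz_S; exact (p_impE _ _ _ _ _ IH h).
Qed.

Lemma allnz_wit {G} (H : list (fm G)) p s :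
  eqv H (allnz p s) Zero -> eqv H (p @ wit p s) Zero.
Proof. intros h; exact (p_impE _ _ _ _ _ (allnz_wit_imp H p s) h). Qed.

Lemma tri_add {G} (H : list (fm G)) x y : H ||- Le (tri x) (tri (add x y)).
Proof.
induct y; [rewrite add_0; apply Le_refl|].
rewrite add_S, tri_S; apply (Le_trans _ _ _ _ IH), Le_add.
Qed.
Lemma tri_mono {G} (H : list (fm G)) x y : H ||- Le x y -> H ||- Le (tri x) (tri y).
Proof. intros h; apply Le_elim in h; rewrite h; apply tri_add. Qed.

Lemma pi2_bounds {G} (H : list (fm G)) n :
  H ||- And (Le (tri (pi2 n)) n) (Lt n (tri (Succ @ pi2 n))).
Proof.
induct n.
- rewrite pi2_0; cbn [num]; apply p_andI; rewrite !tri_S, tri_0, !add_0; [apply Le_0l|].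
  rewrite add_0l; apply Lt_0_S.
- assert (l := p_andE1 _ _ _ _ _ IH); assert (u := p_andE2 _ _ _ _ _ IH); clear IH.
  rewrite pi2_S; cbn [num].
  (* Either [n + 1] is exactly the start of the next block and [pi2] steps, or it is still inside
     the block of [n]. *)
  zcase (monus (tri (Succ @ pi2 n)) (Succ @ n)) as e d.
  + assert (e' : eqv H (tri (Succ @ pi2 n)) (Succ @ n)) by exact (Le_antisym_eqv _ _ _ e u).
    rewrite e, monus_0, add_S, add_0, (tri_S _ (Succ @ pi2 n)), e', add_S.
    apply p_andI; [apply Le_refl|].
    rewrite Lt_SS, add_Sl; rewrite Lt_S_Le; apply Le_add.
  + rewrite e, monus_SS, monus_0l, add_0.
    apply p_andI; [apply (Le_trans _ _ _ _ l), Le_S|].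
    orcase (Lt_or_Le H (Succ @ n) (tri (Succ @ pi2 n))) as k; [exact k|].
    unfold Le in k; fold_eqv; rewrite k in e; symmetry in e; exact (Succ_0_absurd _ _ _ e).
Qed.

(** This bounds the indices of the edges of [G_m], and so the search in [valid]. *)
Lemma Lt_tri_pi2 {G} (H : list (fm G)) n m : H ||- Le (pi2 n) m ->
  H ||- Lt n (tri (Succ @ m)).
Proof.
intros h; apply (Lt_Le_trans _ _ (tri (Succ @ pi2 n)));
  [eapply p_andE2, pi2_bounds|].
now apply tri_mono; rewrite Le_SS.
Qed.

(** Both [pi2 n] and [b] index a block containing [n], and the blocks are disjoint because [tri] is
    monotone. *)
Lemma pi2_pair {G} (H : list (fm G)) a b : H ||- Lt a b ->
  eqv H (pi2 (add (tri b) a)) b.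
Proof.
intros h; set (n := add (tri b) a).
assert (l := p_andE1 _ _ _ _ _ (pi2_bounds H n)).
assert (u := p_andE2 _ _ _ _ _ (pi2_bounds H n)).
assert (l' : H ||- Le (tri b) n) by apply Le_add.
assert (u' : H ||- Lt n (tri (Succ @ b))).
{ rewrite tri_S; unfold Lt, n; rewrite <- add_S; now apply Le_add_mono. }
assert (K : forall H' x y, H' ||- Le (tri x) n -> H' ||- Lt n (tri (Succ @ y)) ->
  H' ||- Le x y).
{ clear; intros H x y h k; orcase (Lt_or_Le H y x) as q; [|exact q].
  apply (Lt_Le_absurd _ n (tri x)); [|exact h].
  now apply (Lt_Le_trans _ _ _ _ k), tri_mono. }
now apply Le_antisym_eqv; apply K.
Qed.

Lemma pi1_pair {G} (H : list (fm G)) a b : H ||- Lt a b ->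
  eqv H (pi1 (add (tri b) a)) a.
Proof. intros h; unfold pi1; rewrite (pi2_pair _ _ _ h); apply add_monus. Qed.

(** * From LPO to graphs *)

Lemma sub_Edge {G D} (f : sub G D) e m n :
  sub_fm (Edge e m n) f = Edge (sub_tm f e) (sub_tm f m) (sub_tm f n).
Proof. unfold Edge; sb; reflexivity. Qed.
#[global] Hint Rewrite @sub_Edge : sb.
Lemma sub_Coloring {G D} (f : sub G D) k e m c :
  sub_fm (Coloring k e m c) f = Coloring k (sub_tm f e) (sub_tm f m) (sub_tm f c).
Proof. unfold Coloring; sb; reflexivity. Qed.
#[global] Hint Rewrite @sub_Coloring : sb.
Lemma sub_Colorable {G D} (f : sub G D) k e m :
  sub_fm (Colorable k e m) f = Colorable k (sub_tm f e) (sub_tm f m).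
Proof. unfold Colorable; sb; reflexivity. Qed.
#[global] Hint Rewrite @sub_Colorable : sb.
Lemma sub_LG_is {G D} (f : sub G D) k e n :
  sub_fm (LG_is k e n) f = LG_is k (sub_tm f e) (sub_tm f n).
Proof. unfold LG_is; sb; reflexivity. Qed.
Lemma sub_LPO_is {G D} (f : sub G D) p n :
  sub_fm (LPO_is p n) f = LPO_is (sub_tm f p) (sub_tm f n).
Proof. unfold LPO_is; sb; reflexivity. Qed.
#[global] Hint Rewrite @sub_LG_is @sub_LPO_is : sb.

Ltac pexcase h c hc :=
  raw; apply (prv_exE _ _ _ h);
  let D := fresh "D" in let H' := fresh "H'" in let f := fresh "Hsub" in
  let m := fresh "Hmor" in intros D H' f c m hc; sb; sb_in hc; lift_morph m.

Ltac pmp h :=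
  match type of h with prv iRCA _ ?H (?A ==> ?B) =>
    cut (H ||- A);
    [let q := fresh in intros q; apply (fun x => p_impE _ _ _ _ _ x q) in h; clear q
    | fold_eqv]
  end.

Lemma mp {G} (H : list (fm G)) A B : H ||- A ==> B -> H ||- A -> H ||- B.
Proof. apply p_impE. Qed.

Lemma Edge_intro {G} (H : list (fm G)) e m a b : H ||- Lt a b -> H ||- Le b m ->
  H ||- Lt Zero (e @ add (tri b) a) -> H ||- Edge e m (add (tri b) a).
Proof.
intros h k l; unfold Edge; rewrite (pi1_pair _ _ _ h), (pi2_pair _ _ _ h).
apply p_andI; [now rewrite <- Lt_0_neq|]; apply p_andI; [|exact k].
apply (Le_trans _ _ b); [now apply Lt_Le | exact k].
Qed.

Lemma Coloring_lt {G} (H : list (fm G)) k e m c i :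
  H ||- Coloring k e m c -> H ||- Le i m -> H ||- Lt (c @ i) (num k).
Proof.
intros h hi; apply p_andE1, (p_allE _ _ _ _ _ i) in h; sb_in h; exact (mp _ _ _ h hi).
Qed.

Lemma Coloring_neq {G} (H : list (fm G)) k e m c a b :
  H ||- Coloring k e m c -> H ||- Lt a b -> H ||- Le b m ->
  H ||- Lt Zero (e @ add (tri b) a) -> H ||- Not (c @ a =0 c @ b).
Proof.
intros h ha hb he; apply p_andE2, (p_allE _ _ _ _ _ (add (tri b) a)) in h; sb_in h.
pmp h; [|now apply Edge_intro].
now rewrite (pi1_pair _ _ _ ha), (pi2_pair _ _ _ ha) in h.
Qed.

Lemma num_le {G} (H : list (fm G)) i j : i <= j -> H ||- Le (num i) (num j).
Proof.
revert j; induction i; intros j h; [apply Le_0l|].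
destruct j; [lia|]; cbn; rewrite Le_SS; apply IHi; lia.
Qed.

(** * The pigeonhole principle and the graph built from a sequence *)

Lemma ForallOrdPairs_impl {A} (R S : A -> A -> Prop) (l : list A) :
  (forall x y, R x y -> S x y) -> ForallOrdPairs R l -> ForallOrdPairs S l.
Proof.
intros h; induction 1; constructor; auto.
eapply Forall_impl; [|eassumption]; auto.
Qed.

Lemma ForallOrdPairs_middle {A} (R : A -> A -> Prop) (l l' : list A) a :
  ForallOrdPairs R (l ++ a :: l') -> ForallOrdPairs R (l ++ l').
Proof.
induction l; cbn; intros h; inversion h; subst; [easy|]; constructor; auto.
rewrite Forall_app in *; destruct H1 as [x y]; inversion y; auto.
Qed.

Lemma ForallOrdPairs_neq_middle {A} (R : A -> A -> Prop) (l l' : list A) a :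
  (forall x y, R x y -> R y x) ->
  ForallOrdPairs R (l ++ a :: l') -> Forall (R a) (l ++ l').
Proof.
intros s; induction l as [|b l IH]; cbn; intros h; inversion h; subst; auto.
constructor; [apply s; rewrite Forall_app in H1; destruct H1 as [_ y]; now inversion y|].
auto.
Qed.

(** Each of the terms is below [k] or equal to [k], provably. At most one can equal [k], and
    dropping it leaves enough terms for the smaller numeral. *)
Lemma pigeonhole k : forall G (H : list (fm G)) (l : list (tm G N)),
  k < length l -> ForallOrdPairs (fun a b => H ||- Not (a =0 b)) l ->
  Forall (fun a => H ||- Lt a (num k)) l -> H ||- Bot.
Proof.
induction k as [|k IH]; intros G H l hl hd hb.
{ destruct l; cbn in hl; [lia|]; inversion hb; subst; eapply Lt_0r; eassumption. }
enough (K : forall (r l0 : list (tm G N)) H, S k < length (l0 ++ r) ->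
  ForallOrdPairs (fun a b => H ||- Not (a =0 b)) (l0 ++ r) ->
  Forall (fun a => H ||- Lt a (num k)) l0 ->
  Forall (fun a => H ||- Lt a (num (S k))) r -> H ||- Bot)
  by (now apply (K l [] H)).
clear - IH; intros r; induction r as [|a r IHr]; intros l0 H hl hd h0 hr.
{ rewrite app_nil_r in *; apply (IH _ _ l0); auto; lia. }
inversion hr as [|? ? ha hr']; subst.
assert (L : forall H' (Q : tm G N -> fm G) l, ext H H' ->
  Forall (fun a => H ||- Q a) l -> Forall (fun a => H' ||- Q a) l).
{ intros H' Q l e; apply Forall_impl; intros b; apply e. }
cbn [num] in ha; rewrite Lt_S_Le in ha.
apply (prv_orE _ _ _ _ (Le_cases _ _ _ ha)); intros H' e h.
- apply (IHr (l0 ++ [a])); rewrite <- ?app_assoc; auto.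
  + revert hd; apply ForallOrdPairs_impl; intros x y; apply e.
  + apply Forall_app; split; [now apply (L _ (fun a => Lt a (num k)))|].
    now constructor.
(* Here [a] equals [k], so the other terms, being different from [a], are below [k]; more than [k]
   of them remain. *)
- fold_eqv.
  assert (ne := ForallOrdPairs_neq_middle _ _ _ _ (fun x y (q : H ||- Not (x =0 y)) =>
     ltac:(pintro s; symmetry in s; exact (mp _ _ _ q s))) hd); cbn in ne.
  apply (IH _ _ (l0 ++ r)).
  + rewrite length_app in *; cbn in hl; lia.
  + apply ForallOrdPairs_middle in hd; revert hd; apply ForallOrdPairs_impl; intros x y; apply e.
  + apply Forall_app; split; [now apply (L _ (fun a => Lt a (num k)))|].
    rewrite Forall_app in ne; destruct ne as [_ ne].
    rewrite Forall_forall in *; intros b hb; specialize (hr' b hb).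
    specialize (ne b hb); apply e in hr', ne; cbn [num] in hr'; rewrite Lt_S_Le in hr'.
    apply (prv_orE _ _ _ _ (Le_cases _ _ _ hr')); intros H2 l2 q; [exact q|].
    lift_ext l2; fold_eqv; apply p_botE; apply (mp _ _ _ ne); fold_eqv.
    now rewrite h, q.
Qed.

(** The outer test lets [gadget_colorable] read [pi1 n < pi2 n] off an edge. For [pi2 n = k + s] the
    value is [allnz p s] where [p] vanishes at [s], hence positive only at the first zero. *)
Definition gadget {G} (k : nat) (p : tm G one) : tm G one :=
  cl (lam (s := one) (lam
    (ifz (monus (Succ @ pi1 #0) (pi2 #0))
       (ifz (monus (Succ @ pi2 #0) (num k)) (num 1)
          (ifz (#1 @ monus (pi2 #0) (num k)) (allnz #1 (monus (pi2 #0) (num k))) Zero))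
       Zero))) @ p.

Lemma sub_gadget {G D} (f : sub G D) k p :
  sub_tm f (gadget k p) = gadget k (sub_tm f p).
Proof. unfold gadget; sb; reflexivity. Qed.
#[global] Hint Rewrite @sub_gadget : sb.

Lemma gadget_val {G} (H : list (fm G)) k p n :
  eqv H (gadget k p @ n)
    (ifz (monus (Succ @ pi1 n) (pi2 n))
       (ifz (monus (Succ @ pi2 n) (num k)) (num 1)
          (ifz (p @ monus (pi2 n) (num k)) (allnz p (monus (pi2 n) (num k))) Zero))
       Zero).
Proof. unfold gadget; rewrite beta2; sb; reflexivity. Qed.

Lemma gadget_low {G} (H : list (fm G)) k p a b : H ||- Lt a b -> H ||- Lt b (num k) ->
  H ||- Lt Zero (gadget k p @ add (tri b) a).
Proof.
intros h l; rewrite gadget_val, (pi1_pair _ _ _ h), (pi2_pair _ _ _ h).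
unfold Lt, Le in h, l; fold_eqv; rewrite h, l, !ifz_0; apply Lt_0_S.
Qed.

Lemma gadget_high {G} (H : list (fm G)) k p a s :
  H ||- Lt a (add (num k) s) -> eqv H (p @ s) Zero -> H ||- Lt Zero (allnz p s) ->
  H ||- Lt Zero (gadget k p @ add (tri (add (num k) s)) a).
Proof.
intros h e q; rewrite gadget_val, (pi1_pair _ _ _ h), (pi2_pair _ _ _ h).
unfold Lt, Le in h; fold_eqv; rewrite h, ifz_0.
zcase (monus (Succ @ add (num k) s) (num k)) as u v; rewrite u.
- rewrite ifz_0; apply Lt_0_S.
- now rewrite ifz_S, add_monus, e, ifz_0.
Qed.

Lemma gadget_not_colorable {G} (H : list (fm G)) k p s :
  eqv H (p @ s) Zero -> H ||- Lt Zero (allnz p s) ->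
  H ||- Not (Colorable k (gadget k p) (add (num k) s)).
Proof.
intros e q; pintro h; pexcase h c hc.
apply (pigeonhole k _ _ (map (fun i => c @ num i) (seq 0 k) ++ [c @ add (num k) s])).
- rewrite length_app, length_map, length_seq; cbn; lia.
(* Generalized to the segments starting at [a], so that each new first vertex is compared with all
   later ones and with [k + s]. *)
- assert (K : forall n a, a + n <= k -> ForallOrdPairs (fun a b => H ||- Not (a =0 b))
     (map (fun i => c @ num i) (seq a n) ++ [c @ add (num k) s])).
  { induction n; intros a ha; cbn; [repeat constructor|].
    constructor; [|apply IHn; lia]; rewrite Forall_app, Forall_map, Forall_forall.
    split; [intros i hi; rewrite in_seq in hi|constructor; [|constructor]].
    + eapply Coloring_neq; [exact hc|apply (num_le _ (S a) i); lia| |].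
      * apply (Le_trans _ _ (num k)); [apply num_le; lia | apply Le_add].
      * apply gadget_low; [apply (num_le _ (S a) i) | apply (num_le _ (S i) k)]; lia.
    + assert (l : H ||- Lt (num a) (add (num k) s))
        by (apply (Lt_Le_trans _ _ (num k)); [apply (num_le _ (S a) k); lia | apply Le_add]).
      eapply Coloring_neq; [exact hc|exact l|apply Le_refl|].
      now apply gadget_high. }
  apply K; lia.
- rewrite Forall_app, Forall_map, Forall_forall; split.
  + intros i hi; rewrite in_seq in hi; apply (Coloring_lt _ _ _ _ _ _ hc).
    apply (Le_trans _ _ (num k)); [apply num_le; lia | apply Le_add].
  + constructor; [|constructor]; apply (Coloring_lt _ _ _ _ _ _ hc), Le_refl.
Qed.

Lemma Colorable_intro {G} (H : list (fm G)) k e m c :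
  H ||- Coloring k e m c -> H ||- Colorable k e m.
Proof. intros h; apply (p_exI _ _ _ _ _ c); sb; exact h. Qed.

(** A vertex [b > k] of [G_m] has [b - (k + 1) < m - k], where [p] has no zero, so it has no smaller
    neighbor. Coloring each [i <= k] by itself and all others by 0 therefore works. *)
Lemma gadget_colorable {G} (H : list (fm G)) k p m :
  H ||- Lt Zero (allnz p (monus m (num k))) ->
  H ||- Colorable (S k) (gadget (S k) p) m.
Proof.
intros h; apply (Colorable_intro _ _ _ _
  (cl (lam (ifz (monus (Succ @ #0) (num (S k))) #0 Zero)))).
assert (V : forall G (H : list (fm G)) i, eqv H
  (cl (lam (ifz (monus (Succ @ #0) (num (S k))) #0 Zero)) @ i)
  (ifz (monus (Succ @ i) (num (S k))) i Zero)) by (intros; rewrite beta1; sb; reflexivity).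
apply p_andI.
- pall i; pintro hi; rewrite V.
  zcase (monus (Succ @ i) (num (S k))) as e u.
  + rewrite e, ifz_0; exact e.
  + rewrite e, ifz_S; apply Lt_0_S.
- pall n; pintro hn; rewrite !V.
  assert (he := p_andE1 _ _ _ _ _ hn); assert (hb := p_andE2 _ _ _ _ _ hn).
  apply p_andE2 in hb; clear hn; rewrite <- Lt_0_neq, gadget_val in he.
  zcase (monus (Succ @ pi1 n) (pi2 n)) as e u.
  + zcase (monus (Succ @ pi2 n) (num (S k))) as e' u'.
    * assert (e2 : eqv H (monus (Succ @ pi1 n) (num (S k))) Zero)
        by exact (Le_trans _ _ _ _ e (Lt_Le _ _ _ e')).
      rewrite e', e2, !ifz_0; apply Lt_neq; exact e.
    * rewrite e, e', ifz_0, ifz_S in he.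
      assert (K : H ||- Lt Zero (p @ monus (pi2 n) (num (S k)))).
      (* [b - (k + 1)] is the predecessor of the positive number [b - k], which is at most
         [m - k]. *)
      { apply (allnz_elim _ _ _ _ h); unfold Lt; cbn [num].
        cbn [num] in e'; rewrite monus_S; rewrite monus_SS in e'.
        rewrite e', pred_S; rewrite <- e'; now apply Le_monus. }
      apply Lt_0_elim in K; rewrite K, ifz_S in he; exact (Lt_0r _ _ _ he).
  + rewrite e, ifz_S in he; exact (Lt_0r _ _ _ he).
Qed.

Lemma Lt_monus_add {G} (H : list (fm G)) x n y :
  H ||- Lt x (monus n y) -> H ||- Lt (add y x) n.
Proof.
intros h; orcase (Lt_or_Le H n y) as k.
- apply Lt_Le in k; unfold Le in k; fold_eqv; rewrite k in h; exact (Lt_0r _ _ _ h).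
- apply Le_elim in k; rewrite k; unfold Lt; rewrite <- add_S; now apply Le_add_mono.
Qed.

Lemma LPO_of_LG {G} (H : list (fm G)) k p n v :
  H ||- LG_is (S k) (gadget (S k) p) n -> eqv H v (monus n (num k)) ->
  H ||- LPO_is p v.
Proof.
intros h hv; assert (h0 := p_andE1 _ _ _ _ _ h); assert (h1 := p_andE2 _ _ _ _ _ h).
clear h; apply p_andI.
- pintro v0.
  zcase n as e u.
  + pmp h0; [|exact e]; pall j.
    enough (K : H ||- Lt Zero (allnz p (Succ @ j)))
      by (apply (allnz_elim _ _ _ _ K), Le_refl).
    assert (K : forall s, H ||- Lt Zero (allnz p s)); [|apply K].
    intros s; induct s; [rewrite allnz_0; apply Lt_0_S|].
    (* A zero at [s] with none before it would make some subgraph uncolorable, against the answer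
       0. *)
    rewrite allnz_S; zcase (p @ s) as q u; [|now rewrite q, ifz_S].
    apply p_botE, (mp _ _ _ (gadget_not_colorable _ (S k) _ _ q IH)).
    apply (p_allE _ _ _ _ _ (add (num (S k)) s)) in h0; sb_in h0; exact h0.
  (* A positive [n] with [n - k = 0] cannot be an answer: a graph on at most [k + 1] vertices is
     colorable by [k + 1] colors. *)
  + pmp h1; [|rewrite e; apply Lt_0_S]; apply p_andE1 in h1.
    apply p_botE, (mp _ _ _ h1), gadget_colorable.
    rewrite <- hv, v0, allnz_0; apply Lt_0_S.
- pintro vp; pmp h1.
  2: { zcase n as e u; [|rewrite e; apply Lt_0_S].
       rewrite hv, e, monus_0l in vp; exact (Lt_0r _ _ _ vp). }
  assert (hn := p_andE1 _ _ _ _ _ h1); apply p_andE2 in h1.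
  assert (ev := Lt_0_elim _ _ vp).
  assert (K : H ||- Lt Zero (allnz p (pred v))).
  { refine (mp _ (Le (pred v) (pred v)) _ _ (Le_refl _ _)).
    (* The second occurrence stays, which turns the goal into an induction on [s] bounded by
       [pred v]. *)
    generalize (pred v) at 1 3; intros s; induct s.
    - pintro q; rewrite allnz_0; apply Lt_0_S.
    - pintro q; rewrite allnz_S; pmp IH; [|now apply Lt_Le].
      zcase (p @ s) as r u; [|now rewrite r, ifz_S].
      apply p_botE, (mp _ _ _ (gadget_not_colorable _ (S k) _ _ r IH)).
      apply (p_allE _ _ _ _ _ (add (num (S k)) s)) in h1; sb_in h1; apply (mp _ _ _ h1).
      (* [s < pred v] gives [s + 1 < v = n - k], hence [k + 1 + s < n], where the graph is still
         colorable. *)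
      cbn [num]; rewrite add_Sl, <- add_S; apply Lt_monus_add.
      rewrite <- hv, ev; now rewrite Lt_S_Le. }
  apply p_andI.
  (* If [p] were positive here as well, it would have no zero below [v = n - k], and [G_n] would be
     colorable. *)
  + zcase (p @ pred v) as q u; [exact q|].
    apply p_botE, (mp _ _ _ hn), gadget_colorable.
    now rewrite <- hv, ev, allnz_S, q, ifz_S.
  + pall t; pintro q; now apply (allnz_elim _ _ _ _ K).
Qed.

(** * From graphs to LPO *)

(** Remainder and quotient are counters run along [n]: the remainder returns to 0 instead of
    reaching [k], and exactly then [divk] advances. *)
Definition modk {G} (k : nat) (n : tm G N) : tm G N :=
  Rec @ n @ Zero @
    cl (lam (s := N) (lam (s := N)
      (ifz (monus (num k) (Succ @ #1)) Zero (Succ @ #1)))).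
Definition divk {G} (k : nat) (n : tm G N) : tm G N :=
  Rec @ n @ Zero @
    cl (lam (s := N) (lam (s := N)
      (ifz (monus (num k) (Succ @ modk k #0)) (Succ @ #1) #1))).
Definition mulk {G} (k : nat) (n : tm G N) : tm G N :=
  Rec @ n @ Zero @ cl (lam (s := N) (lam (s := N) (add #1 (num k)))).
Definition powk {G} (k : nat) (n : tm G N) : tm G N :=
  Rec @ n @ num 1 @ cl (lam (s := N) (lam (s := N) (mulk k #1))).
Definition shr {G} (k : nat) (x j : tm G N) : tm G N :=
  Rec @ j @ x @ cl (lam (s := N) (lam (s := N) (divk k #1))).
(** Horner's scheme in base [k], with the color of the vertex 0 as leading digit. *)
Definition code {G} (k : nat) (c : tm G one) (i : tm G N) : tm G N :=
  Rec @ i @ Zero @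
    (cl (lam (s := one) (lam (s := N) (lam (s := N) (add (mulk k #1) (#2 @ #0))))) @ c).

Lemma sub_modk {G D} (f : sub G D) k n : sub_tm f (modk k n) = modk k (sub_tm f n).
Proof. unfold modk; sb; reflexivity. Qed.
#[global] Hint Rewrite @sub_modk : sb.
Lemma sub_divk {G D} (f : sub G D) k n : sub_tm f (divk k n) = divk k (sub_tm f n).
Proof. unfold divk; sb; reflexivity. Qed.
Lemma sub_mulk {G D} (f : sub G D) k n : sub_tm f (mulk k n) = mulk k (sub_tm f n).
Proof. unfold mulk; sb; reflexivity. Qed.
Lemma sub_powk {G D} (f : sub G D) k n : sub_tm f (powk k n) = powk k (sub_tm f n).
Proof. unfold powk; sb; reflexivity. Qed.
Lemma sub_shr {G D} (f : sub G D) k x j :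
  sub_tm f (shr k x j) = shr k (sub_tm f x) (sub_tm f j).
Proof. unfold shr; sb; reflexivity. Qed.
Lemma sub_code {G D} (f : sub G D) k c i :
  sub_tm f (code k c i) = code k (sub_tm f c) (sub_tm f i).
Proof. unfold code; sb; reflexivity. Qed.
#[global] Hint Rewrite @sub_divk @sub_mulk @sub_powk @sub_shr @sub_code : sb.

Global Instance modk_proper {G} (H : list (fm G)) k :
  Proper (eqv H ==> eqv H) (@modk G k).
Proof. intros a b h; unfold modk; now rewrite h. Qed.
Global Instance divk_proper {G} (H : list (fm G)) k :
  Proper (eqv H ==> eqv H) (@divk G k).
Proof. intros a b h; unfold divk; now rewrite h. Qed.
Global Instance mulk_proper {G} (H : list (fm G)) k :
  Proper (eqv H ==> eqv H) (@mulk G k).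
Proof. intros a b h; unfold mulk; now rewrite h. Qed.
Global Instance shr_proper {G} (H : list (fm G)) k :
  Proper (eqv H ==> eqv H ==> eqv H) (@shr G k).
Proof. intros a b h c d l; unfold shr; now rewrite h, l. Qed.
Global Instance code_proper {G} (H : list (fm G)) k :
  Proper (eqv H ==> eqv H ==> eqv H) (@code G k).
Proof. intros a b h c d l; unfold code; now rewrite h, l. Qed.

Lemma modk_0 {G} (H : list (fm G)) k : eqv H (modk k Zero) Zero.
Proof. apply rec_0. Qed.
Lemma divk_0 {G} (H : list (fm G)) k : eqv H (divk k Zero) Zero.
Proof. apply rec_0. Qed.
Lemma mulk_0 {G} (H : list (fm G)) k : eqv H (mulk k Zero) Zero.
Proof. apply rec_0. Qed.
Lemma powk_0 {G} (H : list (fm G)) k : eqv H (powk k Zero) (num 1).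
Proof. apply rec_0. Qed.
Lemma shr_0 {G} (H : list (fm G)) k x : eqv H (shr k x Zero) x.
Proof. apply rec_0. Qed.
Lemma code_0 {G} (H : list (fm G)) k c : eqv H (code k c Zero) Zero.
Proof. apply rec_0. Qed.
Lemma modk_S {G} (H : list (fm G)) k n : eqv H (modk k (Succ @ n))
  (ifz (monus (num k) (Succ @ modk k n)) Zero (Succ @ modk k n)).
Proof. unfold modk at 1; rewrite rec_S, beta2; sb; reflexivity. Qed.
Lemma divk_S {G} (H : list (fm G)) k n : eqv H (divk k (Succ @ n))
  (ifz (monus (num k) (Succ @ modk k n)) (Succ @ divk k n) (divk k n)).
Proof. unfold divk at 1; rewrite rec_S, beta2; sb; reflexivity. Qed.
Lemma mulk_S {G} (H : list (fm G)) k n :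
  eqv H (mulk k (Succ @ n)) (add (mulk k n) (num k)).
Proof. unfold mulk at 1; rewrite rec_S, beta2; sb; reflexivity. Qed.
Lemma powk_S {G} (H : list (fm G)) k n :
  eqv H (powk k (Succ @ n)) (mulk k (powk k n)).
Proof. unfold powk at 1; rewrite rec_S, beta2; sb; reflexivity. Qed.
Lemma shr_S {G} (H : list (fm G)) k x j :
  eqv H (shr k x (Succ @ j)) (divk k (shr k x j)).
Proof. unfold shr at 1; rewrite rec_S, beta2; sb; reflexivity. Qed.
Lemma code_S {G} (H : list (fm G)) k c i :
  eqv H (code k c (Succ @ i)) (add (mulk k (code k c i)) (c @ i)).
Proof. unfold code at 1; rewrite rec_S, beta3; sb; reflexivity. Qed.

Lemma Lt_monus_pos {G} (H : list (fm G)) x y :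
  H ||- Lt x y -> H ||- Lt Zero (monus y x).
Proof.
intros h; zcase (monus y x) as e u; [|rewrite e; apply Lt_0_S].
exact (Lt_Le_absurd _ _ _ _ h e).
Qed.

Lemma Le_monus_self {G} (H : list (fm G)) x y : H ||- Le (monus x y) x.
Proof.
induct y; [rewrite monus_0; apply Le_refl|].
rewrite monus_S; apply (Le_trans _ _ _ _ (Le_pred _ _ _ IH)).
zcase x as e u; rewrite e; [rewrite pred_0; apply Le_refl|rewrite pred_S; apply Le_S].
Qed.

(** From a multiple of [k + 1] the remainder can advance up to [k] steps without wrapping. *)
Lemma divmod_add {G} (H : list (fm G)) k z r : eqv H (modk (S k) z) Zero ->
  H ||- Le r (num k) ==>
    modk (S k) (add z r) =0 r &&& divk (S k) (add z r) =0 divk (S k) z.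
Proof.
intros h; induct r; pintro l.
- rewrite add_0, h; apply p_andI; fold_eqv; reflexivity.
- pmp IH; [|now apply Lt_Le].
  assert (h1 := p_andE1 _ _ _ _ _ IH); assert (h2 := p_andE2 _ _ _ _ _ IH); fold_eqv.
  assert (q := Lt_0_elim _ _ (Lt_monus_pos _ _ _ l)).
  rewrite add_S, modk_S, divk_S, h1, h2; cbn [num]; rewrite monus_SS, q, !ifz_S.
  apply p_andI; fold_eqv; reflexivity.
Qed.

Lemma divmod_mulk {G} (H : list (fm G)) k y :
  H ||- modk (S k) (mulk (S k) y) =0 Zero &&& divk (S k) (mulk (S k) y) =0 y.
Proof.
induct y.
- rewrite mulk_0, modk_0, divk_0; apply p_andI; fold_eqv; reflexivity.
- assert (h1 := p_andE1 _ _ _ _ _ IH); assert (h2 := p_andE2 _ _ _ _ _ IH); fold_eqv.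
  (* After [k] further steps the remainder is [k]; the step after those wraps and completes the
     multiple. *)
  assert (K := mp _ _ _ (divmod_add _ k _ (num k) h1) (Le_refl _ _)).
  assert (k1 := p_andE1 _ _ _ _ _ K); assert (k2 := p_andE2 _ _ _ _ _ K); fold_eqv.
  rewrite mulk_S; cbn [num]; rewrite add_S, modk_S, divk_S, k1, k2, h2; cbn [num].
  rewrite monus_diag, !ifz_0; apply p_andI; fold_eqv; reflexivity.
Qed.

Lemma modk_digit {G} (H : list (fm G)) k y r : H ||- Lt r (num (S k)) ->
  eqv H (modk (S k) (add (mulk (S k) y) r)) r.
Proof.
intros h; cbn [num] in h; rewrite Lt_S_Le in h.
assert (K := p_andE1 _ _ _ _ _ (divmod_mulk H k y)).
exact (p_andE1 _ _ _ _ _ (mp _ _ _ (divmod_add _ k _ r K) h)).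
Qed.

Lemma divk_digit {G} (H : list (fm G)) k y r : H ||- Lt r (num (S k)) ->
  eqv H (divk (S k) (add (mulk (S k) y) r)) y.
Proof.
intros h; cbn [num] in h; rewrite Lt_S_Le in h.
assert (K := p_andE1 _ _ _ _ _ (divmod_mulk H k y)).
assert (K' := p_andE2 _ _ _ _ _ (divmod_mulk H k y)); fold_eqv.
rewrite <- K' at 2.
exact (p_andE2 _ _ _ _ _ (mp _ _ _ (divmod_add _ k _ r K) h)).
Qed.

Lemma modk_lt {G} (H : list (fm G)) k n : H ||- Lt (modk (S k) n) (num (S k)).
Proof.
induct n; [rewrite modk_0; apply Lt_0_S|].
rewrite modk_S; zcase (monus (num (S k)) (Succ @ modk (S k) n)) as e u;
  rewrite e; [rewrite ifz_0; apply Lt_0_S|rewrite ifz_S].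
orcase (Lt_or_Le H (Succ @ modk (S k) n) (num (S k))) as l; [exact l|].
unfold Le in l; fold_eqv; rewrite l in e; symmetry in e; exact (Succ_0_absurd _ _ _ e).
Qed.

Lemma mulk_mono {G} (H : list (fm G)) k x y :
  H ||- Le x y -> H ||- Le (mulk k x) (mulk k y).
Proof.
intros h; apply Le_elim in h; rewrite h; generalize (monus y x); clear; intros d.
induct d; [rewrite add_0; apply Le_refl|].
rewrite add_S, mulk_S; apply (Le_trans _ _ _ _ IH), Le_add.
Qed.

Lemma code_lt {G} (H : list (fm G)) k e m c i : H ||- Coloring k e m c ->
  H ||- Le i (Succ @ m) ==> Lt (code k c i) (powk k i).
Proof.
intros h; induct i; pintro l.
- rewrite code_0, powk_0; apply Lt_0_S.
- pmp IH; [|now apply Lt_Le].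
  rewrite Le_SS in l; assert (b := Coloring_lt _ _ _ _ _ _ h l).
  rewrite code_S, powk_S; apply (Lt_Le_trans _ _ (mulk k (Succ @ code k c i))).
  + rewrite mulk_S; unfold Lt; rewrite <- add_S; now apply Le_add_mono.
  + now apply mulk_mono.
Qed.

(** By Horner's scheme, dropping the last digit of a code gives the code of a prefix that is shorter
    by one. *)
Lemma shr_code {G} (H : list (fm G)) k e m c j : H ||- Coloring (S k) e m c ->
  H ||- Le j (Succ @ m) ==>
    shr (S k) (code (S k) c (Succ @ m)) j =0 code (S k) c (monus (Succ @ m) j).
Proof.
intros h; induct j; pintro l.
- now rewrite shr_0, monus_0.
- pmp IH; [|now apply Lt_Le]; fold_eqv.
  assert (q := Lt_0_elim _ _ (Lt_monus_pos _ _ _ l)).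
  rewrite shr_S, IH, q, code_S, divk_digit.
  + now rewrite monus_S.
  + apply (Coloring_lt _ _ _ _ _ _ h); rewrite <- monus_S, monus_SS.
    apply Le_monus_self.
Qed.

(** In [code k c (m + 1)] the color of [m] is the last digit, and that of the
    vertex [i] is the digit at position [m - i]. *)
Definition digit {G} (k : nat) (x m i : tm G N) : tm G N :=
  modk k (shr k x (monus m i)).

Lemma sub_digit {G D} (f : sub G D) k x m i :
  sub_tm f (digit k x m i) = digit k (sub_tm f x) (sub_tm f m) (sub_tm f i).
Proof. unfold digit; sb; reflexivity. Qed.
#[global] Hint Rewrite @sub_digit : sb.
Lemma digit_code {G} (H : list (fm G)) k e m c i : H ||- Coloring (S k) e m c ->
  H ||- Le i m -> eqv H (digit (S k) (code (S k) c (Succ @ m)) m i) (c @ i).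
Proof.
intros h l; unfold digit.
assert (K := mp _ _ _ (shr_code _ _ _ _ _ (monus m i) h)
  (Le_trans _ _ _ _ (Le_monus_self _ m i) (Le_S _ m))); fold_eqv.
assert (b := Coloring_lt _ _ _ _ _ _ h l).
assert (E : eqv H (monus (Succ @ m) (monus m i)) (Succ @ i)).
{ apply Le_elim in l; rewrite l at 1.
  now rewrite add_comm, <- add_S, add_monus. }
now rewrite K, E, code_S, modk_digit.
Qed.

(** * Deciding colorability by bounded search *)

Definition dist {G} (a b : tm G N) : tm G N := add (monus a b) (monus b a).
Lemma sub_dist {G D} (f : sub G D) a b :
  sub_tm f (dist a b) = dist (sub_tm f a) (sub_tm f b).
Proof. reflexivity. Qed.
#[global] Hint Rewrite @sub_dist : sb.
Lemma dist_pos {G} (H : list (fm G)) a b :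
  fiff H (Lt Zero (dist a b)) (Not (a =0 b)).
Proof.
apply fiffI; intros H' _ h.
- pintro e; unfold dist in h; rewrite e, monus_diag, add_0 in h; exact (Lt_0r _ _ _ h).
- zcase (dist a b) as e u; [|rewrite e; apply Lt_0_S].
  apply p_botE, (mp _ _ _ h), Le_antisym_eqv.
  + apply Le_0r; rewrite <- e; apply Le_add.
  + apply Le_0r; rewrite <- e; unfold dist; rewrite add_comm; apply Le_add.
Qed.

(** Zero only if [pi n] is an edge of [G_m] whose ends get equal digits of [x]; the value 1 is the
    default for all other [n]. *)
Definition proper_at {G} (k : nat) (e : tm G one) (m x n : tm G N) : tm G N :=
  ifz (e @ n) (num 1) (ifz (monus (pi1 n) m) (ifz (monus (pi2 n) m)
    (dist (digit k x m (pi1 n)) (digit k x m (pi2 n))) (num 1)) (num 1)).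
Lemma sub_proper_at {G D} (f : sub G D) k e m x n :
  sub_tm f (proper_at k e m x n)
  = proper_at k (sub_tm f e) (sub_tm f m) (sub_tm f x) (sub_tm f n).
Proof. unfold proper_at; sb; reflexivity. Qed.
#[global] Hint Rewrite @sub_proper_at : sb.

Definition valid {G} (k : nat) (e : tm G one) (m x : tm G N) : tm G N :=
  allnz (cl (lam (s := one) (lam (s := N) (lam (s := N) (lam (s := N)
    (proper_at k #3 #2 #1 #0))))) @ e @ m @ x) (tri (Succ @ m)).
Lemma sub_valid {G D} (f : sub G D) k e m x :
  sub_tm f (valid k e m x) = valid k (sub_tm f e) (sub_tm f m) (sub_tm f x).
Proof. unfold valid; sb; reflexivity. Qed.
#[global] Hint Rewrite @sub_valid : sb.

Lemma valid_elim {G} (H : list (fm G)) k e m x n : H ||- Lt Zero (valid k e m x) ->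
  H ||- Lt n (tri (Succ @ m)) -> H ||- Lt Zero (proper_at k e m x n).
Proof.
intros h l; assert (K := allnz_elim _ _ _ _ h l); rewrite beta4 in K; now sb_in K.
Qed.

Lemma valid_code {G} (H : list (fm G)) k e m c : H ||- Coloring (S k) e m c ->
  H ||- Lt Zero (valid (S k) e m (code (S k) c (Succ @ m))).
Proof.
intros h; apply allnz_intro; pall n; pintro l; rewrite beta4; sb.
unfold proper_at; zcase (e @ n) as e0 u; rewrite e0; [rewrite ifz_0; apply Lt_0_S|].
rewrite ifz_S; zcase (monus (pi1 n) m) as e1 v; rewrite e1;
  [rewrite ifz_0|rewrite ifz_S; apply Lt_0_S].
zcase (monus (pi2 n) m) as e2 w; rewrite e2;
  [rewrite ifz_0|rewrite ifz_S; apply Lt_0_S].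
rewrite dist_pos, !(digit_code _ _ _ _ _ _ h); [|exact e2|exact e1].
apply p_andE2, (p_allE _ _ _ _ _ n) in h; sb_in h; apply (mp _ _ _ h).
unfold Edge; apply p_andI; [rewrite <- Lt_0_neq, e0; apply Lt_0_S|].
now apply p_andI.
Qed.

(** The digits of any [x] are remainders and so admissible colors; only the edges of [G_m] have to
    be checked. *)
Lemma colorable_valid {G} (H : list (fm G)) k e m x :
  H ||- Lt Zero (valid (S k) e m x) -> H ||- Colorable (S k) e m.
Proof.
intros h; apply (Colorable_intro _ _ _ _
  (cl (lam (s := N) (lam (s := N) (lam (s := N) (digit (S k) #2 #1 #0)))) @ x @ m)).
assert (V : forall G (H : list (fm G)) x m i, eqv H
  (cl (lam (s := N) (lam (s := N) (lam (s := N) (digit (S k) #2 #1 #0)))) @ x @ m @ i)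
  (digit (S k) x m i)) by (intros; rewrite beta3; sb; reflexivity).
apply p_andI.
- pall i; pintro l; rewrite V; apply modk_lt.
- pall n; pintro l; rewrite !V.
  assert (l0 := p_andE1 _ _ _ _ _ l); apply p_andE2 in l.
  assert (l1 := p_andE1 _ _ _ _ _ l); apply p_andE2 in l.
  assert (K := valid_elim _ _ _ _ _ n h (Lt_tri_pi2 _ _ _ l)).
  rewrite <- Lt_0_neq in l0; apply Lt_0_elim in l0.
  unfold Le in l, l1; fold_eqv; unfold proper_at in K.
  now rewrite l0, l, l1, ifz_S, !ifz_0, dist_pos in K.
Qed.

(** The searched sequence is 0 exactly at the valid numbers, so a positive result means that no
    coloring was found. *)
Definition colorings_fail {G} (k : nat) (e : tm G one) (m : tm G N) : tm G N :=
  allnz (cl (lam (s := one) (lam (s := N) (lam (s := N)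
    (ifz (valid k #2 #1 #0) (num 1) Zero)))) @ e @ m) (powk k (Succ @ m)).
Lemma sub_colorings_fail {G D} (f : sub G D) k e m :
  sub_tm f (colorings_fail k e m) = colorings_fail k (sub_tm f e) (sub_tm f m).
Proof. unfold colorings_fail; sb; reflexivity. Qed.
#[global] Hint Rewrite @sub_colorings_fail : sb.

Lemma colorable_search {G} (H : list (fm G)) k e m :
  eqv H (colorings_fail (S k) e m) Zero -> H ||- Colorable (S k) e m.
Proof.
intros h; apply allnz_wit in h; revert h; generalize (wit
  (cl (lam (s := one) (lam (s := N) (lam (s := N)
    (ifz (valid (S k) #2 #1 #0) (num 1) Zero)))) @ e @ m) (powk (S k) (Succ @ m))).
intros x h; rewrite beta3 in h; sb_in h; apply (colorable_valid _ _ _ _ x).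
zcase (valid (S k) e m x) as u v; rewrite u in h |- *; [|apply Lt_0_S].
rewrite ifz_0 in h; exact (Succ_0_absurd _ _ _ h).
Qed.

(** With [colorable_search] this makes colorability decidable intuitionistically: a hypothetical
    coloring has a code within the search bound, and that code would be valid. *)
Lemma not_colorable_search {G} (H : list (fm G)) k e m :
  H ||- Lt Zero (colorings_fail (S k) e m) -> H ||- Not (Colorable (S k) e m).
Proof.
intros h; pintro q; pexcase q c hc.
assert (K := allnz_elim _ _ _ _ h
  (mp _ _ _ (code_lt _ _ _ _ _ (Succ @ m) hc) (Le_refl _ _))).
rewrite beta3 in K; sb_in K.
assert (v := Lt_0_elim _ _ (valid_code _ _ _ _ _ hc)).
rewrite v, ifz_S in K; exact (Lt_0r _ _ _ K).
Qed.

Lemma colorable_0 {G} (H : list (fm G)) k e : H ||- Colorable (S k) e Zero.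
Proof.
apply (Colorable_intro _ _ _ _ (Pi @ Zero)).
assert (V : forall G (H : list (fm G)) (i : tm G N), eqv H (Pi @ Zero @ i) Zero)
  by (intros; apply p_ax, ax_Pi).
(* Every pair has a positive larger component, so [G_0] has no edges. *)
assert (P : forall G (H : list (fm G)) n, H ||- Lt Zero (pi2 n)).
{ clear; intros G H n; induct n; [rewrite pi2_0; apply Lt_0_S|].
  rewrite pi2_S; apply (Lt_Le_trans _ _ _ _ IH), Le_add. }
apply p_andI.
- pall i; pintro l; rewrite V; apply Lt_0_S.
- pall n; pintro l; apply p_andE2, p_andE2 in l.
  exact (Lt_Le_absurd _ _ _ _ (P _ _ n) l).
Qed.

Definition uncolorable_seq {G} (k : nat) (e : tm G one) : tm G one :=
  cl (lam (s := one) (lam (s := N)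
    (ifz (colorings_fail k #1 (Succ @ #0)) (num 1) Zero))) @ e.
Lemma sub_uncolorable_seq {G D} (f : sub G D) k e :
  sub_tm f (uncolorable_seq k e) = uncolorable_seq k (sub_tm f e).
Proof. unfold uncolorable_seq; sb; reflexivity. Qed.
#[global] Hint Rewrite @sub_uncolorable_seq : sb.

Lemma uncolorable_seq_val {G} (H : list (fm G)) k e j :
  eqv H (uncolorable_seq k e @ j)
    (ifz (colorings_fail k e (Succ @ j)) (num 1) Zero).
Proof. unfold uncolorable_seq; rewrite beta2; sb; reflexivity. Qed.

Lemma uncolorable_seq_pos {G} (H : list (fm G)) k e j :
  H ||- Lt Zero (uncolorable_seq (S k) e @ j) -> H ||- Colorable (S k) e (Succ @ j).
Proof.
rewrite uncolorable_seq_val; intros h; apply colorable_search.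
zcase (colorings_fail (S k) e (Succ @ j)) as u v; [exact u|].
rewrite u, ifz_S in h; exact (Lt_0r _ _ _ h).
Qed.

Lemma uncolorable_seq_0 {G} (H : list (fm G)) k e j :
  eqv H (uncolorable_seq (S k) e @ j) Zero ->
  H ||- Not (Colorable (S k) e (Succ @ j)).
Proof.
rewrite uncolorable_seq_val; intros h; apply not_colorable_search.
zcase (colorings_fail (S k) e (Succ @ j)) as u v; rewrite u in h |- *;
  [|apply Lt_0_S].
rewrite ifz_0 in h; exact (Succ_0_absurd _ _ _ h).
Qed.

Lemma leibniz2 {G s t} (H : list (fm G)) (A : fm [t; s]) a a' b b' :
  eqv H a a' -> eqv H b b' ->
  fiff H (sub_fm A (scons b (scons a nosub))) (sub_fm A (scons b' (scons a' nosub))).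
Proof.
intros h k; apply leibniz; apply var_case; [exact k|]; apply var_case; [exact h|].
now intros u v.
Qed.

Global Instance Colorable_proper {G} (H : list (fm G)) k :
  Proper (eqv H ==> eqv H ==> fiff H) (@Colorable G k).
Proof.
intros e e' h m m' h'; generalize (leibniz2 H (Colorable k #1 #0) _ _ _ _ h h'); now sb.
Qed.

Global Instance LG_is_proper {G} (H : list (fm G)) k :
  Proper (eqv H ==> eqv H ==> fiff H) (@LG_is G k).
Proof.
intros e e' h n n' h'; generalize (leibniz2 H (LG_is k #1 #0) _ _ _ _ h h'); now sb.
Qed.

Global Instance LPO_is_proper {G} (H : list (fm G)) :
  Proper (eqv H ==> eqv H ==> fiff H) (@LPO_is G).
Proof.
intros p p' h n n' h'; generalize (leibniz2 H (LPO_is #1 #0) _ _ _ _ h h'); now sb.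
Qed.

Lemma LG_of_LPO {G} (H : list (fm G)) k e n :
  H ||- LPO_is (uncolorable_seq (S k) e) n -> H ||- LG_is (S k) e n.
Proof.
intros h; assert (h0 := p_andE1 _ _ _ _ _ h); assert (h1 := p_andE2 _ _ _ _ _ h).
clear h; apply p_andI; pintro n0.
- pmp h0; [|exact n0]; pall m; zcase m as q u; rewrite q; [apply colorable_0|].
  apply uncolorable_seq_pos; apply (p_allE _ _ _ _ _ u) in h0; now sb_in h0.
- pmp h1; [|exact n0]; assert (hz := p_andE1 _ _ _ _ _ h1); apply p_andE2 in h1.
  apply Lt_0_elim in n0; fold_eqv; apply p_andI.
  + rewrite n0; now apply uncolorable_seq_0.
  + pall t; pintro l; zcase t as q u; rewrite q; [apply colorable_0|].
    apply uncolorable_seq_pos; apply (p_allE _ _ _ _ _ u) in h1; sb_in h1.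
    apply (mp _ _ _ h1); now rewrite q, n0, Lt_SS in l.
Qed.

(** * The formal reductions *)

Lemma sub_holds {G D} (f : sub G D) (P : problem) x y :
  sub_fm (holds P x y) f = holds P (sub_tm f x) (sub_tm f y).
Proof.
unfold holds; rewrite sub_sub_fm; apply sub_fm_ext.
apply var_case; [easy|]; apply var_case; [easy|]; now intros t v.
Qed.
#[global] Hint Rewrite @sub_holds : sb.

Lemma reduces_intro (Q P : problem) (Phi Psi : tm [] (one ~> one)) :
  (forall G (H : list (fm G)) u y,
     H ||- holds P (cl Phi @ u) y -> H ||- holds Q u (cl Psi @ y)) ->
  iRCA0w |-- reduces Q P.
Proof.
intros h; apply (p_exI _ _ _ _ _ (cl Phi)); sb; apply (p_exI _ _ _ _ _ (cl Psi)); sb.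
apply prv_allI; intros D H f u _; sb; apply prv_allI; intros D' H' f' y _; sb.
pintro q; now apply h.
Qed.

Lemma holds_LPO {G} (x y : tm G one) : holds LPO x y = LPO_is x (y @ Zero).
Proof. unfold holds, LPO; now rewrite sub_LPO_is. Qed.
Lemma holds_LG {G} k (x y : tm G one) : holds (LG k) x y = LG_is k x (y @ Zero).
Proof. unfold holds, LG; now rewrite sub_LG_is. Qed.

(** The number is returned as a constant function, since [Psi] has type [1 -> 1]. *)
Definition shift_answer (k : nat) : tm [] (one ~> one) :=
  lam (s := one) (lam (s := N) (monus (#1 @ Zero) (num k))).

Lemma shift_answer_val {G} (H : list (fm G)) k y :
  eqv H (cl (shift_answer k) @ y @ Zero) (monus (y @ Zero) (num k)).
Proof. unfold shift_answer; rewrite beta2; sb; reflexivity. Qed.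

Lemma LPO_le_LG k : iRCA0w |-- reduces LPO (LG (S k)).
Proof.
apply (reduces_intro _ _ (lam (gadget (S k) #0)) (shift_answer k)); intros G H p y.
rewrite holds_LG, holds_LPO, beta1; sb; intros h.
apply (LPO_of_LG _ _ _ _ _ h), shift_answer_val.
Qed.

Lemma LG_le_LPO k : iRCA0w |-- reduces (LG (S k)) LPO.
Proof.
apply (reduces_intro _ _ (lam (uncolorable_seq (S k) #0)) (lam #0)); intros G H e y.
rewrite holds_LG, holds_LPO, !beta1; sb; apply LG_of_LPO.
Qed.

(** The reduction to LPO keeps the answer unchanged, so only the shift for the [k + 1] colors
    remains in [Psi]. *)
Lemma LG_le_LG k j : iRCA0w |-- reduces (LG (S j)) (LG (S k)).
Proof.
apply (reduces_intro _ _ (lam (gadget (S k) (uncolorable_seq (S j) #0)))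
  (shift_answer k)); intros G H e y.
rewrite !holds_LG, beta1; sb; intros h; apply LG_of_LPO.
apply (LPO_of_LG _ _ _ _ _ h), shift_answer_val.
Qed.

Theorem theorem6 :
  forall k j : nat, 1 <= k -> k <= j ->
    iRCA0w |-- And (equivW LPO (LG k)) (equivW (LG k) (LG j)).
Proof.
intros [|k] [|j] hk hj; [lia..|].
unfold equivW; repeat apply p_andI;
  (apply LPO_le_LG || apply LG_le_LPO || apply LG_le_LG).
Qed.
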